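(* Assume $p$ odd, $p\nmid n$, $\ell\ge2$. Let $\tau$ be an $n$-typical matrix and $\rho$ a $\tau$-regular representation of ${\rm GL}_n(\mathfrak o_\ell)$. Then $\mathrm{End}_{{\rm SL}_n(\mathfrak o_\ell)}\big(\mathrm{Res}^{{\rm GL}_n(\mathfrak o_\ell)}_{{\rm SL}_n(\mathfrak o_\ell)}\rho\big)\cong\mathbb C^{\iota(\tau,q-1)}$; i.e. the restriction is a direct sum of exactly $\iota(\tau,q-1)$ pairwise non-isomorphic irreducible representations.
   Context: $\mathfrak o$: ring of integers of a non-archimedean local field, uniformizer $\varpi$, residue field $\mathbf k=\mathbb F_q$ of characteristic $p$; $\mathfrak o_r=\mathfrak o/\varpi^r\mathfrak o$. $K_\ell^{\ell-1}=\ker({\rm GL}_n(\mathfrak o_\ell)\to{\rm GL}_n(\mathfrak o_{\ell-1}))$; fixing a character $\varphi$ of $(\mathfrak o_\ell,+)$ nontrivial on $\varpi^{\ell-1}\mathfrak o_\ell$, each $x\in M_n(\mathbf k)$ gives a character $\varphi_x(I+\varpi^{\ell-1}y)=\varphi(\varpi^{\ell-1}\mathrm{tr}(\hat xy))$. $x$ is regular if its characteristic polynomial equals its minimal polynomial. A nonnegative integer matrix $\tau=(\tau_{d,e})$ is $n$-typical if $\sum_{d,e}de\,\tau_{d,e}=n$. For regular $x$ with characteristic polynomial $\prod_if_i^{e_i}$ ($f_i$ distinct monic irreducible), $\mathbf m^x_{d,e}=\#\{i:\deg f_i=d,e_i=e\}$; $x$ is $\tau$-regular if $\mathbf m^x=\tau$;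 an irreducible representation is $\tau$-regular if its restriction to $K_\ell^{\ell-1}$ contains $\varphi_x$ for a $\tau$-regular $x$. $\iota(\tau,r)=\gcd(\{e:\exists d,\ \tau_{d,e}\ne0\}\cup\{r\})$. *)

(* Defs.v *)
From HB Require Import structures.
From mathcomp Require Import all_boot all_order all_algebra all_fingroup all_solvable all_field all_character.
Set Implicit Arguments. Unset Strict Implicit. Unset Printing Implicit Defensive.
Import Order.TTheory GRing.Theory Num.Theory.
Local Open Scope ring_scope.

Definition SLset (n : nat) (R : finComUnitRingType) : {set {'GL_n[R]}} :=
  [set g : {'GL_n[R]} | \det (GLval g) == 1].

Lemma SLset_group_set n R : group_set (SLset n R).
Proof.
apply/group_setP; split; first by rewrite inE GL_1E det1.
move=> x y; rewrite !inE GL_ME detM => /eqP -> /eqP ->; by rewrite mulr1.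
Qed.
Canonical SL_group n R := Group (SLset_group_set n R).

(* K_l^{l-1} = ker(GL_n(o_l) -> GL_n(o_{l-1})): matrices congruent to 1 mod varpi^(l-1) *)
Definition Kker (n : nat) (R : finComUnitRingType) (varpi : R) (l : nat)
  : {set {'GL_n[R]}} :=
  [set g : {'GL_n[R]} | [exists Y : 'M[R]_n.-1.+1, GLval g == 1 + varpi ^+ l.-1 *: Y]].

(* phi_x (I + varpi^(l-1) y) = phi(varpi^(l-1) tr(xhat y)) = phi(tr(xhat (g - 1))) *)
Definition phi_x (n : nat) (R : finComUnitRingType) (phi : R -> algC)
  (xhat : 'M[R]_n.-1.+1) (g : {'GL_n[R]}) : algC :=
  phi (\tr (xhat *m (GLval g - 1))).

(* "the restriction of chi to the set K contains psi":
   '[Res_K chi, psi]_K != 0, written out (up to the nonzero factor #|K|^-1). *)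
Definition res_contains (gT : finGroupType) (K : {set gT}) (chi psi : gT -> algC) :=
  \sum_(g in K) chi g * (psi g)^* != 0.

Definition regular_mx (F : fieldType) (m : nat) (x : 'M[F]_m.+1) :=
  char_poly x = mxminpoly x.

Definition factor_type (F : fieldType) (m : nat) (x : 'M[F]_m.+1)
  (d e : nat) (f : {poly F}) : Prop :=
  (0 < e)%N /\ [/\ f \is monic, irreducible_poly f, size f = d.+1,
      (f ^+ e %| char_poly x)%R & ~~ (f ^+ e.+1 %| char_poly x)%R].

Definition mtype_is (F : fieldType) (m : nat) (x : 'M[F]_m.+1) (d e N : nat) : Prop :=
  exists s : seq {poly F}, [/\ uniq s, size s = N &
                               forall f, f \in s <-> factor_type x d e f].

Definition tau_regular (F : fieldType) (m : nat) (x : 'M[F]_m.+1)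
  (tau : nat -> nat -> nat) : Prop :=
  regular_mx x /\ forall d e, mtype_is x d e (tau d e).

(* n-typical: nonnegative integer matrix indexed by d, e >= 1 (entries with
   d = 0 or e = 0 are required to vanish; entries with d > n or e > n
   vanish automatically by the sum condition) with sum d e tau_{d,e} = n *)
Definition n_typical (n : nat) (tau : nat -> nat -> nat) : Prop :=
  (forall d e, tau d e != 0%N -> (0 < d <= n) && (0 < e <= n))%N /\
  (\sum_(d < n.+1) \sum_(e < n.+1) d * e * tau d e)%N = n.

(* iota(tau, r) = gcd({e : exists d, tau_{d,e} <> 0} U {r}); for n-typical tau
   the support is contained in [1,n]^2, so the bound n is harmless. *)
Definition iota_tau (n : nat) (tau : nat -> nat -> nat) (r : nat) : nat :=
  gcdn r (\big[gcdn/0%N]_(e < n.+1 | [exists d : 'I_n.+1, tau d e != 0%N]) e).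

(* Main.v *)
(** Write w for varpi, l = i + j with j = l./2, and K^i for the kernel of reduction mod w^i.
    The restriction of chi to K^i contains phi_X for some lift X of x.  By Clifford theory chi
    is induced from an irreducible sigma of the stabiliser S of phi_X; since x is regular, S is
    the product of the units of R[X] and of K^j.  As char_poly x = h^iota, the determinant of an
    element of S is an iota-th power mod w, so S lies in the subgroup T, of index iota, of
    elements with this property, and chi restricted to SL has at least iota constituents.
    Conversely let lambda be a linear character of GL/SL with chi lambda = chi.  Evaluating at
    scalars shows that lambda only depends on the determinant mod w, as p does not divide n.
    Also sigma lambda = sigma.  For a unit c of R[X] of r-power order, r <> p, the constituents
    of sigma restricted to the p-group J = S :&: K^1 are c-invariant (Heisenberg argument),
    hence extend to J<[c]>, and the extensions have degree prime to r and do not vanish at c;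
    this forces lambda c = 1.  Since norms of finite fields are surjective, the determinants of
    the units of R[X] cover all iota-th powers, so lambda is trivial on T.  There are at most
    iota such lambda, that is, the restriction of chi has norm at most iota, whence it is a sum
    of exactly iota distinct irreducibles. *)

Require Import Defs.
From HB Require Import structures.
From mathcomp Require Import all_boot all_order all_algebra all_fingroup all_solvable all_field all_character.
From mathcomp Require Import ring.
Import Order.TTheory GRing.Theory Num.Theory.
Local Open Scope group_scope.
Local Open Scope ring_scope.

Set Implicit Arguments.
Unset Strict Implicit.
Unset Printing Implicit Defensive.

(** * Determinants of polynomials in a matrix *)

Lemma prod_seq_const (R : pzSemiRingType) (I : Type) (s : seq I) (a : R) :
  a ^+ size s = \prod_(i <- s) a.
Proof. by elim: s => [|i s IHs]; rewrite ?big_nil // big_cons -IHs exprS. Qed.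

(** With [P] split into linear factors, the determinant of each [A - b] is, up to sign, the value of
    [char_poly A] at [b]. Exchanging the two products over roots gives this resultant formula. *)
Lemma det_horner_mx (F : closedFieldType) (m : nat) (A : 'M[F]_m.+1)
    (rs : seq F) (P : {poly F}) :
  char_poly A = \prod_(z <- rs) ('X - z%:P) ->
  \det (horner_mx A P) = \prod_(z <- rs) P.[z].
Proof.
move=> charA.
have size_rs : size rs = m.+1.
  by have := size_char_poly A; rewrite charA size_prod_XsubC => -[].
have det_linear b : \det (horner_mx A ('X - b%:P)) = \prod_(z <- rs) (z - b).
  have ->: horner_mx A ('X - b%:P) = - (b%:M - A).
    by rewrite rmorphB /= horner_mx_X horner_mx_C opprB.
  rewrite -scaleN1r detZ.
  have ->: \det (b%:M - A) = (char_poly A).[b].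
    rewrite -horner_evalE -det_map_mx; congr (\det _).
    by apply/matrixP=> i j; rewrite !mxE /= horner_evalE !hornerE hornerMn hornerX.
  rewrite charA horner_prod -size_rs prod_seq_const -big_split /=.
  by apply: eq_bigr => z _; rewrite !hornerE mulN1r opprB.
have [bs Pbs] := closed_field_poly_normal P.
rewrite [in LHS]Pbs linearZ /= detZ rmorph_prod /=.
have ->: \det (\prod_(b <- bs) horner_mx A ('X - b%:P))
     = \prod_(b <- bs) \prod_(z <- rs) (z - b).
  elim: bs {Pbs} => [|b bs IHbs]; first by rewrite !big_nil det1.
  by rewrite !big_cons det_mulmx IHbs det_linear.
rewrite exchange_big /= -size_rs.
rewrite prod_seq_const -big_split /=; apply: eq_bigr => z _.
by rewrite {2}Pbs hornerZ horner_prod; congr (_ * _); apply: eq_bigr => b _; rewrite !hornerE.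
Qed.

Lemma exists_char_poly (R : comNzRingType) (h : {poly R}) (m : nat) :
  h \is monic -> size h = m.+2 -> exists y : 'M[R]_m.+1, char_poly y = h.
Proof.
move=> h_monic size_h; have := companionmxK h_monic.
by move: (companionmx h); rewrite size_h => y char_y; exists y.
Qed.

(** The witness is [\det (horner_mx y P)] for a matrix [y] with characteristic polynomial [h]: over
    an algebraic closure the roots for [x] are those for [y], each repeated [e] times. *)
Lemma det_horner_mx_exp (k : countFieldType) (m : nat) (x : 'M[k]_m.+1)
    (h P : {poly k}) (e : nat) :
  h \is monic -> char_poly x = h ^+ e -> exists u, \det (horner_mx x P) = u ^+ e.
Proof.
move=> h_monic char_x.
have [m' size_h]: exists m', size h = m'.+2.
  have h_gt0 : (0 < size h)%N by rewrite size_poly_gt0 monic_neq0.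
  case size_hE: (size h) h_gt0 => [|[|m']] // _; last by exists m'.
  have h1 : h = 1.
    have := size1_polyC (eq_leq size_hE) => hE.
    by move: (monicP h_monic); rewrite hE lead_coefC => ->.
  by have := size_char_poly x; rewrite char_x h1 expr1n size_poly1.
have [y char_y] := exists_char_poly h_monic size_h.
exists (\det (horner_mx y P)).
have [K [f _]] := countable_algebraic_closure k.
apply: (fmorph_inj f); rewrite rmorphXn /= -!det_map_mx !map_horner_mx.
have [rs] := closed_field_poly_normal (char_poly (map_mx f y)).
rewrite (monicP (char_poly_monic _)) scale1r => char_fy.
have char_fx : char_poly (map_mx f x) = \prod_(z <- flatten (nseq e rs)) ('X - z%:P).
  rewrite -map_char_poly char_x -char_y rmorphXn /= map_char_poly char_fy.
  by elim: (e) => [|e' IHe]; rewrite ?big_nil // big_cat /= -IHe exprS.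
rewrite (det_horner_mx _ char_fx) (det_horner_mx _ char_fy).
by elim: (e) => [|e' IHe]; rewrite ?big_nil // big_cat /= IHe exprS.
Qed.

(** * Finite fields: roots, conjugates and norms *)

Lemma finField_root (L : finFieldType) (N s : nat) (u : L) :
  (0 < N)%N -> #|L|.-1 = (N * s)%N -> u ^+ N = 1 -> exists y, y ^+ s = u.
Proof.
move=> N_gt0 cardL uN1.
have u_unit : u \is a GRing.unit.
  by rewrite unitfE; apply/eqP=> u0; move/eqP: uN1; rewrite u0 expr0n gtn_eqF // eq_sym oner_eq0.
pose U := FinRing.unit _ u_unit.
have /cyclicP[w defL] := field_unit_group_cyclic [set: {unit L}]%G.
have /cycleP[a Ua] : U \in <[w]>%g by rewrite -defL inE.
have order_w : #[w]%g = (N * s)%N by rewrite -cardL -card_finField_unit orderE -defL.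
have UN1 : (U ^+ N)%g = 1%g by apply/val_inj; rewrite /= FinRing.val_unitX.
(* As [w] has order [N * s], this forces [s] to divide the exponent [a]. *)
have: (#[w]%g %| a * N)%N by rewrite order_dvdn expgM -Ua UN1.
rewrite order_w mulnC dvdn_pmul2r // => /dvdnP[b aE].
exists (FinRing.uval (w ^+ b)%g).
by rewrite -FinRing.val_unitX -expgM -aE -Ua.
Qed.

Lemma exprDn_card (F : finFieldType) (L : comNzRingType) (f : {rmorphism F -> L}) (i : nat)
    (a b : L) : (a + b) ^+ (#|F| ^ i) = a ^+ (#|F| ^ i) + b ^+ (#|F| ^ i).
Proof.
apply: exprDn_pchar.
have [p p_pr p_char] := finPcharP F.
have pL : p \in [pchar L] by rewrite (rmorph_pchar f).
have := pprimeChar_pgroup p_char; rewrite /pgroup cardsT => p_card.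
rewrite pnatX (eq_pnat _ (pcharf_eq pL)).
by rewrite p_card.
Qed.

Lemma horner_map_expr_card (F : finFieldType) (L : comNzRingType)
    (f : {rmorphism F -> L}) (i : nat) (Q : {poly F}) (a : L) :
  (map_poly f Q).[a ^+ (#|F| ^ i)] = (map_poly f Q).[a] ^+ (#|F| ^ i).
Proof.
have fix_f c : f c ^+ (#|F| ^ i) = f c.
  by rewrite -rmorphXn /=; congr (f _); elim: i => [|i IHi];
    rewrite ?expr1 // expnS exprM expf_card.
elim/poly_ind: Q => [|Q c IHQ]; first by rewrite rmorph0 !horner0 expr0n expn_eq0 -leqn0 leqNgt
  (ltn_trans _ (finNzRing_gt1 F)).
by rewrite rmorphD rmorphM /= map_polyX map_polyC /= !hornerE IHQ (exprDn_card f) exprMn fix_f.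
Qed.

(** [L] is the quotient of [{poly k}] by [f] and the root is the class of ['X]. Evaluation there is
    reduction modulo [f]. *)
Lemma finField_adjoin_root (k : finFieldType) (f : {poly k}) :
  f \is monic -> irreducible_poly f ->
  exists (L : finFieldType) (g : {rmorphism k -> L}) (a : L),
    [/\ #|L| = (#|k| ^ (size f).-1)%N, root (map_poly g f) a
      & forall y, exists Q : {poly k}, (map_poly g Q).[a] = y].
Proof.
move=> f_monic f_irr; pose fI : monic_irreducible_poly f := (f_irr, f_monic).
pose L : finFieldType := {poly %/ f with fI}.
pose g : {rmorphism k -> L} := qpolyC f.
have horner_g Q : (map_poly g Q).[(in_qpoly f 'X : L)] = in_qpoly f Q :> L.
  by rewrite -[in RHS](comp_polyXr Q) in_qpoly_comp_horner.
exists L, g, (in_qpoly f 'X : L); split; first exact: card_qfpoly.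
- apply/eqP; rewrite horner_g; apply/val_inj => /=.
  by rewrite mk_monicE // Pdiv.RingMonic.rmodpp.
- move=> y; exists (val y : {poly k}); rewrite horner_g; apply/val_inj => /=.
  by rewrite Pdiv.CommonRing.rmodp_small // size_mk_monic.
Qed.

(** The Frobenius conjugates of [a] are roots, since Frobenius fixes the coefficients, and they are
    as many as the degree of [f]; what remains is that they are distinct. *)
Lemma prod_conjugates (k L : finFieldType) (g : {rmorphism k -> L}) (f : {poly k}) (a : L) :
  f \is monic -> #|L| = (#|k| ^ (size f).-1)%N -> root (map_poly g f) a ->
  (forall y, exists Q : {poly k}, (map_poly g Q).[a] = y) ->
  map_poly g f = \prod_(i < (size f).-1) ('X - (a ^+ (#|k| ^ i))%:P).
Proof.
move=> f_monic cardL root_a gen_a; set d := (size f).-1.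
have q_gt1 : (1 < #|k|)%N := finNzRing_gt1 k.
rewrite -(big_mkord xpredT (fun i => 'X - (a ^+ (#|k| ^ i))%:P)) /index_iota subn0.
rewrite -(big_map (fun i => a ^+ (#|k| ^ i)) xpredT (fun z => 'X - z%:P)).
rewrite [LHS](@all_roots_prod_XsubC _ _ [seq a ^+ (#|k| ^ i) | i <- iota 0 d]).
- by rewrite (monicP _) ?scale1r // monic_map.
- rewrite size_map_poly size_map size_iota /d prednK // size_poly_gt0.
  exact: monic_neq0.
- apply/allP=> _ /mapP[i _ ->]; rewrite /root horner_map_expr_card (eqP root_a).
  by rewrite expr0n gtn_eqF // expn_gt0 ltnW.
rewrite uniq_rootsE map_inj_in_uniq ?iota_uniq // => i j.
rewrite !mem_iota /= !add0n.
(* An equality a^(q^i) = a^(q^j) makes a power of Frobenius fix all of L. *)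
wlog le_ij : i j / (i <= j)%N => [wlog_ij|].
  have [le_ij|/ltnW le_ji] := leqP i j; first exact: wlog_ij.
  by move=> lti ltj /esym/(wlog_ij _ _ le_ji ltj lti)/esym.
move=> _ ltj eq_ij; apply/eqP; rewrite eqn_leq le_ij leqNgt /=.
apply/negP=> lt_ij; pose r := (j - i)%N.
have r_gt0 : (0 < r)%N by rewrite subn_gt0.
have frob_inj (b c : L) : b ^+ (#|k| ^ i) = c ^+ (#|k| ^ i) -> b = c.
  move=> bc; have: (b - c) ^+ (#|k| ^ i) = 0.
    by apply: (addIr (c ^+ (#|k| ^ i))); rewrite -(exprDn_card g) subrK add0r.
  by move/eqP; rewrite expf_eq0 subr_eq0 => /andP[_ /eqP].
have frob_a : a ^+ (#|k| ^ r) = a.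
  by apply: frob_inj; rewrite -exprM -expnD subnK // -eq_ij.
have frob_id (y : L) : y ^+ (#|k| ^ r) = y.
  by have [Q <-] := gen_a y; rewrite -horner_map_expr_card frob_a.
have p_gt1 : (1 < #|k| ^ r)%N by rewrite -[1%N](expn0 #|k|) ltn_exp2l.
have sizeP : size ('X^(#|k| ^ r) - 'X : {poly L}) = (#|k| ^ r).+1.
  by rewrite size_polyDl size_polyXn // size_polyN size_polyX.
(* All elements of [L] are roots of this polynomial of degree [#|k| ^ r], so [d <= r], whereas
   [r <= j < d]. *)
have := @max_poly_roots L ('X^(#|k| ^ r) - 'X) (enum L).
rewrite -size_poly_eq0 sizeP -cardE enum_uniq cardL ltnS => /(_ isT).
rewrite leq_exp2l // => lt_dr.
suff: (d <= r)%N by rewrite leqNgt => /negP[]; apply: leq_ltn_trans ltj; apply: leq_subr.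
rewrite -ltnS -/d in lt_dr *.
apply: lt_dr => //; apply/allP=> y _.
by rewrite rootE !hornerE frob_id subrr.
Qed.

(** This is surjectivity of the norm from k[X]/f to k: the roots of [f] contribute the norm of an
    element, [e] times over, and the roots of [c] contribute 1. *)
Lemma exists_det_horner_exp (k : finFieldType) (m : nat) (x : 'M[k]_m.+1)
    (f c : {poly k}) (e : nat) (u : k) :
  f \is monic -> irreducible_poly f -> char_poly x = f ^+ e * c -> coprimep f c ->
  u != 0 -> exists P, \det (horner_mx x P) = u ^+ e.
Proof.
move=> f_monic f_irr char_x /Bezout_eq1_coprimepP[[v w] /= vw1] u0.
have [L [g [a [cardL root_a gen_a]]]] := finField_adjoin_root f_monic f_irr.
set d := (size f).-1 in cardL.
have q_gt1 : (1 < #|k|)%N := finNzRing_gt1 k.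
(* The norm is the power map with exponent [s], and the unit group of [L] has order
   [#|k|.-1 * s]. *)
pose s := (\sum_(i < d) #|k| ^ i)%N.
have [y ys] : exists y, y ^+ s = g u.
  apply: (@finField_root _ #|k|.-1); first by rewrite -ltnS prednK // ltnW.
    by rewrite cardL predn_exp.
  apply/eqP; rewrite -rmorphXn /= fmorph_eq1; apply/eqP.
  apply: (mulfI u0); rewrite mulr1 -exprS prednK ?expf_card //.
  exact: ltnW.
have [Q Qa] := gen_a y.
(* P agrees with Q modulo f and with 1 modulo c. *)
exists (1 + (Q - 1) * (w * c)).
have [K [h _]] := countable_algebraic_closure L.
pose hg : {rmorphism k -> K} := h \o g.
have hgE p z : (map_poly hg p).[h z] = h (map_poly g p).[z].
  by rewrite map_poly_comp horner_map.
have [cs] := closed_field_poly_normal (map_poly hg c).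
have c_monic : c \is monic.
  by have := char_poly_monic x; rewrite char_x monicMl // monic_exp.
rewrite (monicP _) ?monic_map // scale1r => csE.
pose ra := [seq h (a ^+ (#|k| ^ i)) | i <- iota 0 d].
have raE : map_poly hg f = \prod_(z <- ra) ('X - z%:P).
  rewrite map_poly_comp (prod_conjugates f_monic cardL root_a gen_a) rmorph_prod /=.
  rewrite big_map (_ : iota 0 d = index_iota 0 d); last by rewrite /index_iota subn0.
  rewrite big_mkord.
  by apply: eq_bigr => i _; rewrite rmorphB /= map_polyX map_polyC.
have char_hx : char_poly (map_mx hg x)
    = \prod_(z <- flatten (nseq e ra) ++ cs) ('X - z%:P).
  rewrite -map_char_poly char_x rmorphM rmorphXn /= csE raE big_cat /=; congr (_ * _).
  by elim: (e) => [|e' IHe]; rewrite ?big_nil // big_cat /= -IHe exprS.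
apply: (fmorph_inj hg); rewrite -det_map_mx map_horner_mx (det_horner_mx _ char_hx).
have cs1 : \prod_(z <- cs) (map_poly hg (1 + (Q - 1) * (w * c))).[z] = 1.
  rewrite big_seq big1 // => z z_cs.
  have /eqP cz0 : root (map_poly hg c) z by rewrite csE root_prod_XsubC.
  by rewrite !rmorphD !rmorphM !rmorph1 !hornerD !hornerM cz0 !mulr0 addr0 hornerC.
rewrite big_cat /= cs1 mulr1 !rmorphXn /= -ys.
transitivity ((\prod_(z <- ra) (map_poly hg (1 + (Q - 1) * (w * c))).[z]) ^+ e).
  by elim: (e) => [|e' IHe]; rewrite ?big_nil // big_cat /= IHe exprS.
congr (_ ^+ e); rewrite big_map (_ : iota 0 d = index_iota 0 d); last by rewrite /index_iota subn0.
rewrite big_mkord expr_sum rmorph_prod.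
apply: eq_bigr => i _; rewrite hgE; congr (h _).
have fa0 : (map_poly g f).[a ^+ (#|k| ^ i)] = 0.
  by rewrite horner_map_expr_card (eqP root_a) expr0n gtn_eqF // expn_gt0 ltnW.
have wc1 : (map_poly g (w * c)).[a ^+ (#|k| ^ i)] = 1.
  have -> : w * c = 1 - v * f by rewrite -vw1 addrC addKr.
  by rewrite rmorphB rmorph1 rmorphM /= !hornerE fa0 mulr0 subr0.
rewrite rmorphD (rmorphM _ (Q - 1)) rmorphB !rmorph1 hornerD hornerM wc1 mulr1.
by rewrite hornerD hornerN hornerC addrC subrK horner_map_expr_card Qa.
Qed.

(** * Factorisation of polynomials into irreducibles *)

Lemma exists_irreducible_factor (k : finFieldType) (p : {poly k}) :
  (1 < size p)%N -> exists f, [/\ f \is monic, irreducible_poly f & f %| p].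
Proof.
have [n] := ubnP (size p); elim: n p => // n IHn p lt_pn p_gt1.
have p0 : p != 0 by rewrite -size_poly_gt0 ltnW.
have [p_irr|] := altP (irreducibleP p).
  exists ((lead_coef p)^-1 *: p); have lp0 : (lead_coef p)^-1 != 0 by rewrite invr_eq0
    lead_coef_eq0.
  split; first by rewrite monicE lead_coefZ mulVf ?lead_coef_eq0.
    split; first by rewrite size_scale.
    move=> q q1; rewrite dvdpZr // => /(p_irr.2 q q1)/eqp_trans->; rewrite // eqp_sym.
    exact: eqp_scale.
  by rewrite dvdpZl.
rewrite /irreducibleb p_gt1 /= negb_forall => /existsP[q];
  rewrite negb_imply -ltnNge => /andP[q_dvd q_gt1].
have qp : (q : {poly k}) %| p by rewrite Pdiv.Idomain.dvdpE.
have q_lt : (size q < n)%N.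
  by rewrite (leq_ltn_trans (size_npoly q)) // prednK ?(ltnW p_gt1) //; move: lt_pn;
    rewrite ltnS; case: (size p) p_gt1 => // [[|s]].
have [f [f_monic f_irr fq]] := IHn _ q_lt q_gt1.
by exists f; split=> //; apply: dvdp_trans qp.
Qed.

Lemma irreducible_coprimep (k : fieldType) (f c : {poly k}) :
  irreducible_poly f -> ~~ (f %| c) -> coprimep f c.
Proof.
move=> f_irr; apply: contraR; rewrite /coprimep => gcd1.
by rewrite -(eqp_dvdl _ (f_irr.2 _ gcd1 (dvdp_gcdl f c))) dvdp_gcdr.
Qed.

Lemma coprimep_irreducible_ndvd (k : fieldType) (f c : {poly k}) :
  irreducible_poly f -> coprimep f c -> ~~ (f %| c).
Proof.
move=> f_irr fc; apply/negP=> f_dvd; have : coprimep f f by rewrite (coprimep_dvdl f_dvd).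
by rewrite coprimepp => /eqP size_f; have := f_irr.1; rewrite size_f.
Qed.

Lemma exists_multiplicity (k : fieldType) (f p : {poly k}) :
  f \is monic -> irreducible_poly f -> p != 0 ->
  exists e c, p = f ^+ e * c /\ coprimep f c.
Proof.
move=> f_monic f_irr; have [n] := ubnP (size p); elim: n p => // n IHn p lt_pn p0.
have [/dvdpP[q pE]|] := boolP (f %| p); last first.
  by move=> /(irreducible_coprimep f_irr) ?; exists 0%N, p; rewrite mul1r.
have q0 : q != 0 by apply: contraNneq p0 => q0; rewrite pE q0 mul0r.
have lt_qn : (size q < n)%N.
  move: lt_pn; rewrite ltnS; apply: leq_trans; rewrite pE size_Mmonic //.
  by case: (size f) f_irr.1 => [|[|s]] // _; rewrite !addnS /= ltnS leq_addr.
have [e [c [qE fc]]] := IHn q lt_qn q0.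
by exists e.+1, c; split=> //; rewrite pE qE mulrC exprS mulrA.
Qed.

(** The full power of one irreducible factor is split off at a time, so that the two factors are
    coprime and Bezout arguments apply. *)
Lemma poly_coprime_ind (k : finFieldType) (Pr : {poly k} -> Prop) :
  Pr 1 ->
  (forall f e c, f \is monic -> irreducible_poly f -> (0 < e)%N -> c \is monic ->
     coprimep f c -> Pr c -> Pr (f ^+ e * c)) ->
  forall p, p \is monic -> Pr p.
Proof.
move=> Pr1 PrM p; have [n] := ubnP (size p); elim: n p => // n IHn p lt_pn p_monic.
have [p_gt1|p_le1] := ltnP 1 (size p); last first.
  suff -> : p = 1 by [].
  by move: (monicP p_monic); rewrite [p]size1_polyC // lead_coefC => ->.
have [f [f_monic f_irr f_dvd]] := exists_irreducible_factor p_gt1.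
have [e [c [pE fc]]] := exists_multiplicity f_monic f_irr (monic_neq0 p_monic).
have c_monic : c \is monic by rewrite -(monicMl c (monic_exp e f_monic)) -pE.
have e_gt0 : (0 < e)%N.
  rewrite lt0n; apply/eqP=> e0; move: f_dvd; rewrite pE e0 mul1r => f_dvd.
  by case/negP: (coprimep_irreducible_ndvd f_irr fc).
rewrite pE; apply: PrM => //; apply: IHn => //.
move: lt_pn; rewrite ltnS; apply: leq_trans.
rewrite pE size_Mmonic ?monic_exp // ?expf_neq0 ?monic_neq0 //.
have : (0 < (size (f ^+ e)%R).-1)%N.
  by rewrite size_exp muln_gt0 e_gt0 andbT; case: (size f) f_irr.1 => [|[]].
by case: (size (f ^+ e)%R) => [|[|s]] // _; rewrite !addSn /= ltnS leq_addl.
Qed.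

Lemma dvdp_exp_mul_coprime (k : fieldType) (f g c : {poly k}) (e e' : nat) :
  coprimep f c -> (0 < e')%N -> g ^+ e' %| c ->
  forall d, (g ^+ d %| f ^+ e * c) = (g ^+ d %| c).
Proof.
move=> fc e'_gt0 gc d.
apply: Gauss_dvdpr; apply: coprimep_expl; apply: coprimep_expr.
have g_dvd : g %| c by apply: dvdp_trans gc; apply: dvdp_exp.
by rewrite coprimep_sym (coprimep_dvdl g_dvd).
Qed.

Lemma monic_root_of_multiplicities (k : finFieldType) (i : nat) (p : {poly k}) :
  p \is monic ->
  (forall f e, f \is monic -> irreducible_poly f -> (0 < e)%N ->
     f ^+ e %| p -> ~~ (f ^+ e.+1 %| p) -> (i %| e)%N) ->
  exists2 h, h \is monic & p = h ^+ i.
Proof.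
move: p; apply: poly_coprime_ind => [_|f e c f_monic f_irr e_gt0 c_monic fc IHc mult].
  by exists 1; rewrite ?monic1 ?expr1n.
have [g g_monic cE] : exists2 h, h \is monic & c = h ^+ i.
  apply: IHc => g d g_monic g_irr d_gt0 gc gNc.
  by apply: (mult g) => //; rewrite (dvdp_exp_mul_coprime e fc d_gt0 gc).
have /dvdnP[r eE] : (i %| e)%N.
  apply: (mult f) => //; first exact: dvdp_mulr.
  rewrite exprSr dvdp_mul2l; first exact: coprimep_irreducible_ndvd.
  by rewrite expf_neq0 // monic_neq0.
exists (f ^+ r * g); first by rewrite monicMl ?monic_exp.
by rewrite exprMn -exprM -eE cE.
Qed.

(** * Cyclic vectors and centralisers of regular matrices *)

Lemma exists_vector_annihilator (k : finFieldType) (m : nat) (x : 'M[k]_m.+1) (p : {poly k}) :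
  p \is monic -> p %| mxminpoly x ->
  exists v : 'rV_m.+1, forall q, (v *m horner_mx x q == 0) = (p %| q).
Proof.
move: p; apply: poly_coprime_ind => [_|f e c f_monic f_irr e_gt0 c_monic fc IHc p_dvd].
  by exists 0 => q; rewrite mul0mx eqxx dvd1p.
have [v2 v2P] := IHc (dvdp_trans (dvdp_mull _ (dvdpp c)) p_dvd).
have fe_dvd := dvdp_trans (dvdp_mulr _ (dvdpp (f ^+ e))) p_dvd.
have [h hE] := dvdpP _ _ fe_dvd.
have h_nz : h != 0 by apply/eqP=> h0; have := monic_neq0 (mxminpoly_monic x);
  rewrite hE h0 mul0r eqxx.
have fe0 d : f ^+ d != 0 by rewrite expf_neq0 ?monic_neq0.
have size_f := f_irr.1.
(* By minimality some [v1] is not killed by [h * f ^+ e.-1]; its image under [h] then has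
   annihilator exactly [f ^+ e]. Adding [v2], whose annihilator [c] is coprime to it, multiplies the
   annihilators. *)
have : horner_mx x (h * f ^+ e.-1) != 0.
  rewrite -dvd_mxminpoly hE dvdp_mul2l // -{1}(prednK e_gt0).
  by rewrite dvdp_Pexp2l // ltnn.
case/rowV0Pn=> _ /submxP[v1 ->] v1_nz.
have v1P q : (v1 *m horner_mx x (h * q) == 0) = (f ^+ e %| q).
  apply/idP/idP=> [q0|/dvdpP[r ->]]; last first.
    by rewrite mulrCA -hE rmorphM /= mx_root_minpoly mulr0 mulmx0.
  have [->|q_nz] := eqVneq q 0; first exact: dvdp0.
  have [d [r [qE fr]]] := exists_multiplicity f_monic f_irr q_nz.
  have [le_ed|lt_de] := leqP e d; first by rewrite qE dvdp_mulr // dvdp_exp2l.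
  have /Bezout_eq1_coprimepP[[a b] /= ab1] := coprimep_expl (e - d) fr.
  case/negP: v1_nz.
  have -> : h * f ^+ e.-1 = mxminpoly x * (a * f ^+ (e.-1 - d)) + (h * q) * (b * f ^+ (e.-1 - d)).
    have -> : f ^+ e.-1 = f ^+ d * f ^+ (e.-1 - d).
      by rewrite -exprD subnKC // -ltnS prednK.
    rewrite hE qE -{1}[f ^+ d]mulr1 -ab1.
    have -> : f ^+ e = f ^+ d * f ^+ (e - d) by rewrite -exprD subnKC // ltnW.
    ring.
  rewrite rmorphD /= mulmxDr (rmorphM _ (mxminpoly x)) /= mx_root_minpoly mul0r mulmx0 add0r.
  by rewrite (rmorphM _ (h * q)) /= -mulmxE mulmxA (eqP q0) mul0mx.
exists (v1 *m horner_mx x h + v2) => q.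
have v1E r : v1 *m horner_mx x h *m horner_mx x r = v1 *m horner_mx x (h * r).
  by rewrite -mulmxA mulmxE -rmorphM.
rewrite Gauss_dvdp ?coprimep_expl //; apply/idP/andP=> [/eqP q0|[fq cq]]; last first.
  rewrite mulmxDl v1E; move: fq; rewrite -v1P => /eqP->.
  by move: cq; rewrite -v2P => /eqP->; rewrite addr0.
have qr0 r : v1 *m horner_mx x (h * (q * r)) + v2 *m horner_mx x (q * r) = 0.
  by rewrite -v1E -mulmxDl rmorphM /= -mulmxE mulmxA q0 mul0mx.
split.
  rewrite -(Gauss_dvdpl _ (q := c)) ?coprimep_expl // -v1P.
  have /eqP v2q : v2 *m horner_mx x (q * c) == 0 by rewrite v2P dvdp_mull.
  by rewrite -[X in X == _]addr0 -[X in _ + X]v2q qr0.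
rewrite -(Gauss_dvdpl _ (q := f ^+ e)) 1?coprimep_sym ?coprimep_expl // -v2P.
have /eqP v1q : v1 *m horner_mx x (h * (q * f ^+ e)) == 0 by rewrite v1P dvdp_mull.
by rewrite -[X in X == _]add0r -[X in X + _]v1q qr0.
Qed.

(** A regular matrix has a cyclic vector [v], and a matrix commuting with [x] is determined by the
    image of [v]. *)
Lemma regular_centralizer (k : finFieldType) (m : nat) (x y : 'M[k]_m.+1) :
  Defs.regular_mx x -> x *m y = y *m x -> exists P, y = horner_mx x P.
Proof.
move=> x_reg xy.
have [v vP] := exists_vector_annihilator (mxminpoly_monic x) (dvdpp _).
(* The rows are v, vx, ..., vx^m; they are independent because no nonzero polynomial of degree at
   most [m] in [x] kills [v]. *)
pose W := \matrix_(i < m.+1) (v *m horner_mx x 'X^i).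
have mulW u : u *m W = v *m horner_mx x (rVpoly u).
  rewrite mulmx_sum_row [in RHS](row_sum_delta u) !linear_sum /=; apply: eq_bigr => i _.
  by rewrite rowK !linearZ /= rVpoly_delta.
have W_unit : W \in unitmx.
  rewrite -row_free_unit -kermx_eq0; apply/rowV0P=> u /sub_kermxP/eqP.
  rewrite mulW vP -x_reg => u_dvd; rewrite -[u]rVpolyK.
  have [->|u_nz] := eqVneq (rVpoly u) 0; first by rewrite linear0.
  by have := dvdp_leq u_nz u_dvd; rewrite size_char_poly leqNgt ltnS size_poly.
pose u := v *m y *m invmx W; exists (rVpoly u).
(* [D] commutes with [x] and kills [v], hence kills every row of [W]. *)
apply/eqP; rewrite -subr_eq0; set D := y - _.
have xD : comm_mx x D.
  by apply: comm_mxB => //; apply: comm_mx_horner.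
have vD : v *m D = 0.
  by rewrite mulmxBr -mulW mulmxKV // subrr.
rewrite -[D](mulKmx W_unit); apply/eqP.
have -> : W *m D = 0; last by rewrite mulmx0.
apply/row_matrixP=> i; rewrite row_mul rowK -mulmxA row0.
have /comm_mx_sym -> := comm_mx_horner 'X^i (comm_mx_sym xD).
by rewrite mulmxA vD mul0mx.
Qed.

(** * Exponents attained by determinants of polynomials in [x] *)

Section DeterminantImage.
Variables (k : finFieldType) (m : nat) (x : 'M[k]_m.+1).

Let attains (e : nat) :=
  forall u : k, u != 0 -> exists P, \det (horner_mx x P) = u ^+ e.

Lemma attains_gcd (a b : nat) : attains a -> attains b -> attains (gcdn a b).
Proof.
move=> Ha Hb; case: a Ha => [|a] Ha; first by rewrite gcd0n.
have attD c d : attains c -> attains d -> attains (c + d)%N.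
  move=> Hc Hd u u0; have [P PE] := Hc u u0; have [Q QE] := Hd u u0.
  by exists (P * Q); rewrite rmorphM /= -mulmxE det_mulmx PE QE exprD.
have att0 : attains 0%N.
  by move=> u _; exists 1; rewrite rmorph1 -idmxE det1.
have attM c d : attains c -> attains (d * c)%N.
  by move=> Hc; elim: d => // d IHd; rewrite mulSn; apply: attD.
have [s t gcdE _] := egcdnP b (ltn0Sn a).
(* In the Bezout relation the coefficient -t is replaced by [t * #|k|.-2], which agrees with it
   modulo the exponent [#|k|.-1] of the unit group. *)
move=> u u0; have [P PE] := attD _ _ (attM _ s Ha) (attM _ (t * #|k|.-2)%N Hb) u u0.
exists P; rewrite {}PE gcdE addnAC -mulnA [(#|k|.-2 * b)%N]mulnC mulnA -mulnS.
have -> : #|k|.-2.+1 = #|k|.-1 by rewrite prednK // -ltnS prednK ?finNzRing_gt1 // ltnW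
  ?finNzRing_gt1.
have uq1 : u ^+ #|k|.-1 = 1.
  apply: (mulfI u0); rewrite mulr1 -exprS prednK ?expf_card //.
  exact: ltnW (finNzRing_gt1 k).
by rewrite exprD mulnC exprM uq1 expr1n mul1r.
Qed.

Variables (n : nat) (tau : nat -> nat -> nat).
Hypotheses (tau_typical : n_typical n tau) (x_tau : tau_regular x tau).
Let iota := iota_tau n tau (#|k| - 1).

(** Each exact multiplicity [e] of an irreducible factor of [char_poly x] occurs in [tau], so [iota]
    divides it and [char_poly x] is an [iota]-th power. *)
Lemma det_horner_iota (P : {poly k}) :
  exists u, \det (horner_mx x P) = u ^+ iota.
Proof.
have [h h_monic hE] : exists2 h, h \is monic & char_poly x = h ^+ iota.
  apply: monic_root_of_multiplicities (char_poly_monic x) _.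
  move=> f e f_monic f_irr e_gt0 f_dvd f_ndvd.
  have [s [_ size_s sP]] := x_tau.2 (size f).-1 e.
  have f_s : f \in s.
    by apply/sP; split=> //; split=> //; rewrite prednK // ltnW // f_irr.1.
  have tau0 : tau (size f).-1 e != 0%N by rewrite -size_s; case: (s) f_s.
  have /andP[/andP[_ d_le] /andP[_ e_le]] := tau_typical.1 _ _ tau0.
  apply: dvdn_trans (dvdn_gcdr _ _) _.
  apply: (@biggcdn_inf _ (Ordinal (e_le : (e < n.+1)%N))) => //.
  by apply/existsP; exists (Ordinal (d_le : ((size f).-1 < n.+1)%N)).
exact: det_horner_mx_exp h_monic hE.
Qed.

(** Attained exponents are closed under gcd, so it suffices to attain [#|k| - 1], where the power of
    [u] is 1, and each multiplicity [e] occurring in [tau]. *)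
Lemma exists_det_horner_iota (u : k) :
  u != 0 -> exists P, \det (horner_mx x P) = u ^+ iota.
Proof.
move: u; rewrite -/(attains iota).
have att0 : attains 0%N.
  by move=> u _; exists 1; rewrite rmorph1 -idmxE det1.
apply: attains_gcd.
  move=> u u0; exists 1; rewrite rmorph1 -idmxE det1.
  apply: (mulfI u0); rewrite mulr1 -exprS subn1 prednK ?expf_card //.
  exact: ltnW (finNzRing_gt1 k).
apply: (big_ind attains) => // [a b|e /existsP[d tau0]]; first exact: attains_gcd.
have [s [_ size_s sP]] := x_tau.2 d e.
have [f f_s] : exists f, f \in s.
  by case: (s) size_s => [s0|f s' _]; [rewrite -s0 in tau0 | exists f; rewrite inE eqxx].
have [e_gt0 [f_monic f_irr _ f_dvd f_ndvd]] := (sP f).1 f_s.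
have [e' [c [charE fc]]] := exists_multiplicity f_monic f_irr (monic_neq0 (char_poly_monic x)).
have le_exp a : (f ^+ a %| char_poly x) = (a <= e')%N.
  rewrite charE Gauss_dvdpl ?coprimep_expl // dvdp_Pexp2l //.
  exact: f_irr.1.
have eE : e' = e by apply/eqP; rewrite eqn_leq -ltnS ltnNge -!le_exp f_ndvd f_dvd.
by move=> u; apply: exists_det_horner_exp f_monic f_irr _ fc; rewrite charE eE.
Qed.

End DeterminantImage.

(** * Characters *)

Lemma eqAmodX (e x y : algC) (n : nat) :
  x \in Aint -> y \in Aint -> (x == y %[mod e])%A -> (x ^+ n == y ^+ n %[mod e])%A.
Proof.
move=> Ax Ay xy; elim: n => [|n IHn]; first by rewrite !expr0 eqAmod_refl.
by rewrite !exprS; apply: eqAmodM => //; apply: rpredX.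
Qed.

Lemma eqAmod_exprD (r a : nat) (x y : algC) : prime r -> x \in Aint -> y \in Aint ->
  ((x + y) ^+ (r ^ a)%N == x ^+ (r ^ a)%N + y ^+ (r ^ a)%N %[mod r%:R])%A.
Proof.
move=> r_pr.
have base z w : z \in Aint -> w \in Aint ->
    ((z + w) ^+ r == z ^+ r + w ^+ r %[mod r%:R])%A.
  move=> Az Aw; case: r r_pr => // r r_pr.
  rewrite exprDn big_ord_recl big_ord_recr /= subn0 expr0 mulr1 subnn expr0 mul1r bin0 binn !mulr1n.
  rewrite addrCA -[X in (_ == X %[mod _])%A]add0r eqAmodDr.
  rewrite eqAmod0; apply: rpred_sum => i _; rewrite -mulr_natr -eqAmod0.
  have /dvdnP[b ->] : (r.+1 %| 'C(r.+1, bump 0 i))%N.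
    by rewrite prime_dvd_bin // /bump /= add1n ltnS /= ltn_ord.
  rewrite natrM mulrA; apply: eqAmodMl0.
  by rewrite !rpredM ?rpredX ?rpred_nat.
move=> Ax Ay; elim: a => [|a IHa]; first by rewrite expn0 !expr1.
rewrite expnSr !exprM.
apply: eqAmod_trans (base _ _ (rpredX _ Ax) (rpredX _ Ay)).
by apply: eqAmodX IHa; rewrite ?rpredD ?rpredX ?rpredD.
Qed.

(** On [<[c]>] the character is a sum of linear characters whose values at [c] have [r ^ a]-th power
    1, and raising to this power is additive modulo [r]. *)
Lemma char_expr_mod (gT : finGroupType) (G : {group gT}) (chi : 'CF(G)) (c : gT) (r a : nat) :
  chi \is a character -> c \in G -> prime r -> (c ^+ (r ^ a) = 1)%g ->
  (chi c ^+ (r ^ a)%N == chi 1%g %[mod r%:R])%A.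
Proof.
move=> Nchi Gc r_pr c1; have sCG : <[c]> \subset G by rewrite cycle_subG.
rewrite -(cfResE chi sCG (cycle_id c)) -(cfRes1 <[c]> chi).
have Nphi : 'Res[<[c]>] chi \is a character by apply: cfRes_char.
move: ('Res[_] _) Nphi => phi /char_sum_irr[s ->].
suff [] : \sum_(i <- s) 'chi_i c \in Aint /\
    ((\sum_(i <- s) 'chi[<[c]>]_i c) ^+ (r ^ a)%N == \sum_(i <- s) 'chi_i 1%g %[mod r%:R])%A.
  by rewrite !sum_cfunE.
elim: s => [|i s [As IHs]].
  have ra0 : (r ^ a == 0)%N = false by apply/negbTE; rewrite -lt0n expn_gt0 prime_gt0.
  by split; rewrite !big_nil ?rpred0 // expr0n ra0 eqAmod_refl.
have lin_i : 'chi_i \is a linear_char by apply/char_abelianP; apply: cycle_abelian.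
have Ai : 'chi_i c \in Aint by apply: Aint_irr.
rewrite !big_cons; split; first by rewrite rpredD.
apply: eqAmod_trans (eqAmod_exprD a r_pr Ai As) _.
apply: eqAmodD IHs; rewrite -lin_charX ?cycle_id // c1.
exact: eqAmod_refl.
Qed.

Lemma char_r_elt_neq0 (gT : finGroupType) (G : {group gT}) (i : Iirr G) (c : gT) (r : nat) :
  c \in G -> prime r -> r.-elt c -> coprime r (Num.truncn ('chi_i 1%g)) -> 'chi_i c != 0.
Proof.
move=> Gc r_pr /p_natP[a order_c] cop; apply/eqP=> chi0.
have := @char_expr_mod _ _ 'chi_i c r a (irr_char i) Gc r_pr.
rewrite -order_c expg_order => /(_ erefl).
rewrite chi0 expr0n gtn_eqF ?order_gt0 //= eqAmod_sym.
rewrite -(truncnK (Cnat_irr1 i)) eqAmod0_nat => r_dvd.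
by move: cop; rewrite prime_coprime // r_dvd.
Qed.

(** An element where the character reaches its degree in absolute value acts by a scalar. *)
Lemma irr_scalar_mul (gT : finGroupType) (G : {group gT}) (i : Iirr G) (g z : gT) :
  g \in G -> z \in G -> `|'chi_i z| = 'chi_i 1%g ->
  'chi_i (g * z)%g * 'chi_i 1%g = 'chi_i g * 'chi_i z.
Proof.
move=> Gg Gz; rewrite -irrRepr; move: ('Chi_i) => rG.
move=> /(max_cfRepr_norm_scalar Gz)[c _ rz].
rewrite !cfunE groupM // Gg Gz group1 !mulr1n repr_mxM // rz repr_mx1.
by rewrite mul_mx_scalar !mxtraceZ !mxtrace_scalar -[c *+ _]mulr_natr; ring.
Qed.

(** [g * [~ g, h]] is a conjugate of [g], while the commutator acts by a scalar other than 1. *)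
Lemma irr_commutator_eq0 (gT : finGroupType) (G : {group gT}) (i : Iirr G) (g h : gT) :
  g \in G -> h \in G -> `|'chi_i [~ g, h]| = 'chi_i 1%g ->
  'chi_i [~ g, h] != 'chi_i 1%g -> 'chi_i g = 0.
Proof.
move=> Gg Gh norm_gh gh_neq1.
have := irr_scalar_mul Gg (groupR Gg Gh) norm_gh.
rewrite /commg mulKVg -/(commg g h) cfunJ // => /eqP.
rewrite -subr_eq0 -mulrBr mulf_eq0 subr_eq0 => /orP[/eqP//|/eqP E].
by rewrite E eqxx in gh_neq1.
Qed.

Lemma irr1_pnat (gT : finGroupType) (G : {group gT}) (p : nat) (i : Iirr G) :
  p.-group G -> p.-nat (Num.truncn ('chi_i 1%g)).
Proof.
move=> pG; apply: (pnat_dvd _ pG); have := dvd_irr1_cardG i.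
by rewrite -{1}(truncnK (Cnat_irr1 i)) dvdC_nat.
Qed.

Lemma constt_Res_cfclass (gT : finGroupType) (G H : {group gT}) (i : Iirr G) (j k : Iirr H) :
  H <| G -> j \in irr_constt ('Res[H] 'chi_i) -> k \in irr_constt ('Res[H] 'chi_i) ->
  'chi_k \in ('chi_j ^: G)%CF.
Proof.
move=> nsHG i_j; rewrite irr_consttE (Clifford_Res_sum_cfclass nsHG i_j).
apply: contraR => k_notin; rewrite cfdotZl cfdot_suml big_seq big1 ?mulr0 // => chi j_chi.
have /cfclassP[y Gy chiE] := j_chi; rewrite chiE -conjg_IirrE cfdot_irr.
case: eqP => // jk; case/negP: k_notin; rewrite -jk conjg_IirrE.
by apply/cfclassP; exists y.
Qed.

(* The invariant constituent of the p-group extends to J<[c]>, so the constituents of the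
   restriction to J<[c]> have degree prime to r and do not vanish at c. *)
Lemma twist_fixed_eq1 (gT : finGroupType) (S J : {group gT}) (p r : nat)
    (i : Iirr S) (lambda : 'CF(S)) (c : gT) :
  J <| S -> p.-group J -> prime r -> r != p -> c \in S -> r.-elt c ->
  lambda \is a linear_char -> J \subset cfker lambda -> 'chi_i * lambda = 'chi_i ->
  (forall j, j \in irr_constt ('Res[J] 'chi_i) -> ('chi_j ^ c)%CF = 'chi_j) ->
  (forall s, s \in S -> exists a h, [/\ s = (a * h)%g, a \in S, commute a c & h \in J]) ->
  lambda c = 1.
Proof.
move=> nsJS pJ r_pr r_neq_p Sc r_c lin_lam kerJ fix_lam inv_c decS.
have [sJS nJS] := andP nsJS; have nJc : c \in 'N(J) := subsetP nJS c Sc.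
pose H := (J <*> <[c]>)%G.
have sJH : J \subset H := joing_subl _ _.
have Hc : c \in H by rewrite (subsetP (joing_subr _ _)) ?cycle_id.
have sHS : H \subset S by rewrite join_subG sJS cycle_subG.
have nsJH : J <| H := normalS sJH sHS nsJS.
(* For [s = a * h], the factor [a] centralises [c] and [h] lies in [H], so conjugation by [s] keeps
   [c] in [H]. *)
have nsHS : H <| S.
  rewrite /normal sHS; apply/subsetP=> s Ss; rewrite inE.
  have [a [h [-> Sa ac Jh]]] := decS s Ss.
  rewrite /H /= -genJ conjUg gen_subG subUset (normP (subsetP nJS _ _)); last first.
    by rewrite groupM // (subsetP sJS).
  rewrite sJH -cycleJ cycle_subG conjgM.
  have -> : (c ^ a = c)%g by rewrite conjgE -ac mulKg.
  by rewrite groupJ // (subsetP sJH).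
have indexHJ : r.-nat #|H : J|.
  rewrite -card_quotient; last exact: normal_norm nsJH.
  rewrite /H /= quotientYidl ?cycle_subG // quotient_cycle //.
  exact: morph_p_elt.
have cop m : p.-nat m -> coprime #|H : J| m.
  move=> pm; apply: pnat_coprime indexHJ _; apply: sub_in_pnat pm => q _ /eqnP->.
  by rewrite !inE eq_sym.
pose phi := 'Res[H] 'chi_i.
have Nphi : phi \is a character by rewrite cfRes_char ?irr_char.
have [j phi_j] : exists j, j \in irr_constt phi.
  have [|j phi_j] := @neq0_has_constt _ H phi; last by exists j.
  by rewrite cfRes_eq0 ?irr_char ?irr_neq0.
have [t j_t] : exists t, t \in irr_constt ('Res[J] 'chi_j).
  have [|t j_t] := @neq0_has_constt _ J ('Res[J] 'chi_j); last by exists t.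
  by rewrite cfRes_eq0 ?irr_char ?irr_neq0.
have i_t : t \in irr_constt ('Res[J] 'chi_i).
  by have := constt_Res_trans Nphi phi_j j_t; rewrite cfResRes.
have inv_t : H \subset 'I['chi_t].
  rewrite /H /= join_subG sub_inertia cycle_subG inE nJc /=.
  by rewrite inv_c.
have degree_t := irr1_pnat t pJ.
have solHJ : solvable (H / J).
  rewrite /H /= quotientYidl ?cycle_subG // quotient_cycle //.
  exact/abelian_sol/cycle_abelian.
(* [H / J] is an [r]-group, while the degree and the determinantal order of ['chi_t] are powers of
   [p]: the coprime extension theorem applies. *)
have cop_t : coprime #|H : J| ('o('chi_t)%CF * Num.truncn ('chi_t 1%g)).
  rewrite coprimeMr !cop // (pnat_dvd _ pJ) //.
  exact/cforder_lin_char_dvdG/cfDet_lin_char.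
have [e [res_e _ _]] := extend_solvable_coprime_irr nsJH solHJ inv_t cop_t.
(* The characters of [H] above ['chi_t] are the extension times linear characters of the cyclic
   quotient. *)
have degree_j : 'chi_j 1%g = 'chi_t 1%g.
  have [irrM _ imE _] := constt_Ind_ext nsJH res_e.
  move: j_t; rewrite -constt_Ind_Res imE => /codomP[b ->].
  rewrite cfIirrE ?irrM // cfunE -res_e cfRes1 lin_char1 ?mul1r // mod_IirrE //.
  apply: cfMod_lin_char; apply/char_abelianP.
  rewrite /H /= quotientYidl ?cycle_subG // quotient_cycle //.
  exact: cycle_abelian.
have j_c : 'chi_j c != 0.
  apply: (char_r_elt_neq0 _ r_pr r_c) => //; rewrite degree_j.
  apply: pnat_coprime (pnat_id r_pr) _; apply: sub_in_pnat degree_t => q _ /eqnP->.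
  by rewrite !inE eq_sym.
have lin_lamH : 'Res[H] lambda \is a linear_char by apply: cfRes_lin_char.
have /irrP[j' j'E] : 'chi_j * 'Res[H] lambda \in irr H.
  by rewrite mulrC mul_lin_irr ?mem_irr.
have phi_j' : j' \in irr_constt phi.
  have phi_lam : phi * 'Res[H] lambda = phi by rewrite /phi -rmorphM /= fix_lam.
  rewrite irr_consttE -j'E -{}phi_lam.
  suff -> : '[phi * 'Res[H] lambda, 'chi_j * 'Res[H] lambda] = '[phi, 'chi_j] by [].
  rewrite !cfdotE; congr (_ * _); apply: eq_bigr => h Hh.
  rewrite !cfunE rmorphM mulrACA -normCK normC_lin_char //.
  by rewrite expr1n mulr1.
(* The twist of ['chi_j] is a conjugate of it by [y], and [y^-1 = a * h] moves [c] only within its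
   [H]-class; comparing values at [c] gives the claim. *)
have /cfclassP[y Sy j'_conj] := constt_Res_cfclass nsHS phi_j phi_j'.
have [a [h [yE Sa ac Jh]]] := decS _ (groupVr Sy).
have := congr1 (fun xi : 'CF(H) => xi c) j'_conj.
rewrite -j'E cfunE cfConjgE ?(subsetP (normal_norm nsHS)) // cfResE //.
rewrite yE conjgM (_ : c ^ a = c)%g; last by rewrite conjgE -ac mulKg.
rewrite cfunJ ?(subsetP sJH) // => /eqP; rewrite -subr_eq0 -[X in _ - X]mulr1 -mulrBr.
by rewrite mulf_eq0 (negPf j_c) subr_eq0 => /eqP.
Qed.

(** * Clifford theory and restriction to a normal subgroup with abelian quotient *)

Lemma clifford_correspondent (gT : finGroupType) (G K : {group gT}) (i : Iirr G) (t : Iirr K) :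
  K <| G -> t \in irr_constt ('Res[K] 'chi_i) ->
  exists s : Iirr 'I_G['chi_t], [/\ 'Ind[G] 'chi_s = 'chi_i,
    t \in irr_constt ('Res[K] 'chi_s) &
    forall lambda : 'CF(G), lambda \is a linear_char -> K \subset cfker lambda ->
      'chi_i * lambda = 'chi_i -> 'chi_s * 'Res lambda = 'chi_s].
Proof.
move=> nsKG i_t; pose S := 'I_G['chi_t]%G.
have sSG : S \subset G := Inertia_sub G 'chi_t.
have sKS : K \subset S := sub_Inertia 'chi_t (normal_sub nsKG).
have [indI indK im_ind _ _] := constt_Inertia_bijection t nsKG.
have : i \in irr_constt ('Ind[G] 'chi_t) by rewrite constt_Ind_Res.
rewrite -im_ind => /imsetP[s t_s iE]; exists s.
have indE : 'Ind[G] 'chi_s = 'chi_i by rewrite iE cfIirrE // indI.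
have s_t : t \in irr_constt ('Res[K] 'chi_s) by rewrite -constt_Ind_Res.
split=> // lambda lin_lam kerK fix_lam.
have lin_lamS : 'Res[S] lambda \is a linear_char by apply: cfRes_lin_char.
have /irrP[s' s'E] : 'chi_s * 'Res[S] lambda \in irr S.
  by rewrite mulrC mul_lin_irr ?mem_irr.
(* The twist of ['chi_s] still lies above [t], since [lambda] is trivial on [K], and induces to
   ['chi_i]; the Clifford correspondence is injective. *)
rewrite s'E; congr 'chi_ _; apply: indK => //.
  rewrite /= constt_Ind_Res -s'E rmorphM /= cfResRes //.
  by rewrite (cfRes_sub_ker kerK) lin_char1 // scale1r mulr1.
by apply: irr_inj; rewrite -iE cfIirrE -s'E cfIndM // indE fix_lam ?mem_irr.
Qed.

Lemma constt_Res_invariant (gT : finGroupType) (S J K : {group gT}) (s : Iirr S)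
    (j : Iirr J) (t : Iirr K) :
  K <| S -> J \subset S -> K \subset J -> S \subset 'I['chi_t] -> 'chi_t \is a linear_char ->
  t \in irr_constt ('Res[K] 'chi_s) -> j \in irr_constt ('Res[J] 'chi_s) ->
  'Res[K] 'chi_j = 'chi_j 1%g *: 'chi_t.
Proof.
move=> nsKS sJS sKJ inv_t lin_t s_t s_j.
have constt_j u : u \in irr_constt ('Res[K] 'chi_j) -> u = t.
  move=> j_u; have s_u : u \in irr_constt ('Res[K] 'chi_s).
    rewrite -(cfResRes _ sKJ sJS); apply: constt_Res_trans s_j _ j_u.
    by rewrite cfRes_char ?irr_char.
  have := constt_Res_cfclass nsKS s_t s_u.
  by rewrite cfclass_invariant // inE => /eqP/irr_inj.
have jE : 'Res[K] 'chi_j = '['Res[K] 'chi_j, 'chi_t] *: 'chi_t.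
  rewrite {1}['Res[K] 'chi_j]cfun_sum_cfdot (bigD1 t) //= big1 ?addr0 // => u u_neq_t.
  suff /eqP-> : '['Res[K] 'chi_j, 'chi_u] == 0 by rewrite scale0r.
  by apply: contraNT u_neq_t => /constt_j->.
rewrite [LHS]jE; congr (_ *: _).
by rewrite -(cfRes1 K) jE cfunE lin_char1 // mulr1 -jE.
Qed.

(** The sum of the squared multiplicities counts the twists fixing ['chi_i], at most [#|G : T|]. The
    sum of the multiplicities is at least [#|G : T|], as ['chi_i] is induced through [T]. Hence all
    multiplicities are 0 or 1. *)
Lemma Res_multiplicity_free (gT : finGroupType) (G N T S : {group gT}) (i : Iirr G) (s : Iirr S) :
  N <| G -> T <| G -> N \subset T -> abelian (G / N) -> S \subset T ->
  'Ind[G] 'chi_s = 'chi_i ->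
  (forall lambda : 'CF(G), lambda \is a linear_char -> N \subset cfker lambda ->
     'chi_i * lambda = 'chi_i -> T \subset cfker lambda) ->
  exists A : {set Iirr N}, #|A| = #|G : T| /\ 'Res[N] 'chi_i = \sum_(j in A) 'chi_j.
Proof.
move=> nsNG nsTG sNT abGN sST indE kerT.
have sNG := normal_sub nsNG; have sTG := normal_sub nsTG.
pose a j := Num.truncn '['Res[N] 'chi_i, 'chi_j].
have NRes : 'Res[N] 'chi_i \is a character by rewrite cfRes_char ?irr_char.
have aE j : '['Res[N] 'chi_i, 'chi_j] = (a j)%:R.
  by rewrite truncnK // Cnat_cfdot_char_irr.
have ub : (\sum_j a j ^ 2 <= #|G : T|)%N.
  have lin_mod (b : Iirr (G / N)) : 'chi_(mod_Iirr b) \is a linear_char.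
    by rewrite mod_IirrE // cfMod_lin_char //; apply/char_abelianP.
  have res0 : 'Res[N] 'chi[G]_0 = 'chi_0 by rewrite !irr0 rmorph1.
  have [_ _ _ ind1E] := constt_Ind_ext nsNG res0.
  pose D := [set b : Iirr (G / N) | 'chi_i * 'chi_(mod_Iirr b) == 'chi_i].
  have normE : \sum_j (a j ^ 2)%:R = #|D|%:R :> algC.
    transitivity '['Res[N] 'chi_i].
      rewrite cfdot_sum_irr; apply: eq_bigr => j _.
      by rewrite aE conj_natr ?natr_nat // -natrM mulnn.
    (* By Frobenius reciprocity the norm is the pairing of ['chi_i] with its product by the
       character induced from the trivial one of [N], which is the sum of the characters of
       [G / N]. *)
    rewrite cfdot_Res_l -['Res[N] 'chi_i]mul1r cfIndM // -irr0 ind1E mulr_suml cfdot_sumr.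
    rewrite -sum1_card natr_sum [RHS]big_mkcond /=; apply: eq_bigr => b _.
    rewrite inE -scalerAl cfdotZr /mul_mod_Iirr cfIirrE; last first.
      by rewrite irr0 mulr1 mem_irr.
    have /irrP[i' i'E] : 'chi_i * 'chi_(mod_Iirr b) \in irr G.
      by rewrite mulrC mul_lin_irr ?mem_irr.
    rewrite irr0 mulr1 [_ * 'chi_i]mulrC i'E cfdot_irr (inj_eq irr_inj) eq_sym.
    by rewrite (lin_char1 _) ?conjC1 ?mul1r //; [case: eqP | apply/char_abelianP].
  rewrite -(ler_nat algC) natr_sum normE ler_nat.
  (* The twists fixing ['chi_i] factor through the abelian group [G / T], which has [#|G : T|]
     irreducible characters. *)
  have kerD b : b \in D -> T \subset cfker 'chi_(mod_Iirr b).
    by rewrite inE => /eqP; apply: kerT => //; rewrite mod_IirrE ?cfker_mod.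
  have inj_D : {in D &, injective (fun b => quo_Iirr T (mod_Iirr b))}.
    move=> b b' Db Db' /= /(congr1 (@mod_Iirr _ G T)).
    rewrite !quo_IirrK ?kerD // => /(congr1 (quo_Iirr N)).
    by rewrite !mod_IirrK.
  rewrite -(card_in_imset inj_D) (leq_trans (max_card _)) // card_ord NirrE.
  have abGT : abelian (G / T).
    by apply: sub_der1_abelian; apply: subset_trans sNT; apply: der1_min => //; apply: normal_norm.
  by rewrite -card_quotient ?normal_norm //; move: abGT; rewrite card_classes_abelian => /eqP->.
have lb : (#|G : T| <= \sum_j a j)%N.
  pose psi := 'Res[N] ('Ind[T] 'chi_s).
  have Npsi : psi \is a character by rewrite cfRes_char ?cfInd_char ?irr_char.
  have psi_neq0 : psi != 0.
    rewrite cfRes_eq0 ?cfInd_char ?irr_char // -char1_eq0 ?cfInd_char ?irr_char //.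
    by rewrite cfInd1 // mulf_neq0 ?irr1_neq0 // pnatr_eq0 -lt0n indexg_gt0.
  (* On [N] the formula for induction from [T] is a sum of conjugates of [psi], each of which has at
     least one constituent. *)
  have resE : #|T|%:R *: 'Res[N] 'chi_i = \sum_(y in G) (psi ^ y)%CF.
    apply/cfun_inP=> x Nx; rewrite cfunE cfResE // -indE -(cfIndInd _ sTG sST) cfIndE //.
    rewrite mulrA divff ?neq0CG // mul1r sum_cfunE (reindex_inj invg_inj) /=.
    apply: eq_big => [y|y Gy]; first by rewrite groupV.
    rewrite groupV in Gy; rewrite cfConjgE ?(subsetP (normal_norm nsNG)) //.
    by rewrite cfResE // memJ_norm ?groupV ?(subsetP (normal_norm nsNG)).
  have mult_ge1 y : 1 <= \sum_j '[(psi ^ y)%CF, 'chi_j].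
    have Nphi : (psi ^ y)%CF \is a character by rewrite cfConjg_char.
    have phi_neq0 : (psi ^ y)%CF != 0 
      by apply: contraNneq psi_neq0 => psi0; rewrite -(cfConjgK y psi) psi0 rmorph0.
    have [j phi_j] := neq0_has_constt phi_neq0.
    rewrite (bigD1 j) //= ler_wpDr ?sumr_ge0 // => [k _|].
      by rewrite natr_ge0 // Cnat_cfdot_char_irr.
    move: phi_j; rewrite irr_consttE.
    by have /natrP[m ->] := Cnat_cfdot_char_irr j Nphi; rewrite pnatr_eq0 ler1n lt0n.
  have cardE : (#|T| * \sum_j a j)%:R = \sum_(y in G) \sum_j '[(psi ^ y)%CF, 'chi_j] :> algC.
    rewrite exchange_big /= natrM natr_sum mulr_sumr; apply: eq_bigr => j _.
    by rewrite -aE -cfdotZl resE cfdot_suml.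
  rewrite -(leq_pmul2l (cardG_gt0 T)) Lagrange // -(ler_nat algC) cardE -sum1_card natr_sum.
  by apply: ler_sum => y _; apply: mult_ge1.
have le_sq j : (a j <= a j ^ 2)%N by case: (a j) => // b; rewrite leq_pmulr.
have sum_eq : (\sum_j a j = \sum_j a j ^ 2)%N.
  apply/eqP; rewrite eqn_leq leq_sum //=; exact: leq_trans ub lb.
have eq_sq j : a j = (a j ^ 2)%N.
  have := sum_eq; rewrite (bigD1 j) //= [RHS](bigD1 j) //= => E.
  apply/eqP; rewrite eqn_leq le_sq /= -(leq_add2r (\sum_(k | k != j) a k)) E leq_add2l.
  exact: leq_sum.
have a01 j : a j = (a j == 1%N) by have := eq_sq j; case: (a j) => [|[|b]] // /eqP;
  rewrite -{1}[b.+2]muln1 eqn_pmul2l.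
exists [set j | a j == 1%N]; split.
  rewrite -sum1_card big_mkcond /=.
  transitivity (\sum_j a j)%N; last by apply/eqP; rewrite eqn_leq lb sum_eq ub.
  by apply: eq_bigr => j _; rewrite inE [RHS]a01; case: eqP.
rewrite ['Res[N] 'chi_i]cfun_sum_cfdot [RHS]big_mkcond /=; apply: eq_bigr => j _.
by rewrite inE aE a01; case: eqP => _; rewrite ?scale1r ?scale0r.
Qed.

(** * Matrices over a chain ring *)

Lemma scalemx_factor (R : finComUnitRingType) (m n : nat) (c : R) (M : 'M[R]_(m, n)) :
  (forall i j, exists b, M i j = c * b) -> exists M', M = c *: M'.
Proof.
move=> Mc; exists (\matrix_(i, j) odflt 0 [pick b | M i j == c * b]).
apply/matrixP=> i j; rewrite !mxE; case: pickP => [b /eqP //|no_b].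
by have [b /eqP] := Mc i j; rewrite no_b.
Qed.

Lemma exists_GLval (n : nat) (R : finComUnitRingType) (A : 'M[R]_n.-1.+1) :
  A \in unitmx -> exists g : {'GL_n[R]}, GLval g = A.
Proof. by move=> A_unit; exists (FinRing.unit _ A_unit). Qed.

Lemma GLval_inj (n : nat) (R : finComUnitRingType) : injective (@GLval n R).
Proof. exact: val_inj. Qed.

Section ChainRing.
Variables (R : finComUnitRingType) (varpi : R) (l : nat)
  (k : finFieldType) (pi : {rmorphism R -> k}).
Hypotheses (varpi_l : varpi ^+ l = 0) (varpi_neq0 : varpi ^+ l.-1 != 0).
Hypothesis ker_pi : forall a : R, pi a = 0 <-> exists b, a = varpi * b.
Hypothesis pi_surj : forall c : k, exists a, pi a = c.

Lemma chain_length_gt0 : (0 < l)%N.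
Proof. by case: l varpi_l varpi_neq0 => // /eqP; rewrite expr0 oner_eq0. Qed.

Lemma pi_varpi : pi varpi = 0.
Proof. by apply/ker_pi; exists 1; rewrite mulr1. Qed.

Lemma varpi_expr_eq0 (e : nat) : (varpi ^+ e == 0) = (l <= e)%N.
Proof.
apply/idP/idP=> [e0|le_e]; last by rewrite -(subnKC le_e) exprD varpi_l mul0r.
rewrite leqNgt; apply: contra varpi_neq0 => lt_el.
have le_el : (e <= l.-1)%N by rewrite -ltnS prednK // chain_length_gt0.
by rewrite -(subnKC le_el) exprD (eqP e0) mul0r.
Qed.

(** If [b] lifts the inverse of [pi a], then [1 - a * b] is nilpotent and a geometric series inverts
    [a * b]. *)
Lemma unit_pi (a : R) : (a \is a GRing.unit) = (pi a != 0).
Proof.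
apply/idP/idP=> [a_unit|pia]; first by rewrite -unitfE rmorph_unit.
have [b pib] := pi_surj (pi a)^-1.
have /ker_pi[c abE] : pi (1 - a * b) = 0.
  by rewrite rmorphB rmorphM rmorph1 pib divff ?subrr.
have := subrX1 (1 - a * b) l; rewrite {1}abE exprMn varpi_l mul0r sub0r.
rewrite addrAC subrr sub0r mulNr => /oppr_inj E.
by apply/unitrPr; exists (b * \sum_(i < l) (1 - a * b) ^+ i); rewrite mulrA.
Qed.

(** Divide by [varpi] until the cofactor is a unit; after [l] divisions the element is 0. *)
Lemma chain_factor (a : R) :
  a = 0 \/ exists v u, [/\ (v < l)%N, u \is a GRing.unit & a = varpi ^+ v * u].
Proof.
suff [[b ->]|//] : (exists b, a = varpi ^+ l * b) \/
    exists v u, [/\ (v < l)%N, u \is a GRing.unit & a = varpi ^+ v * u].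
- by left; rewrite varpi_l mul0r.
- by right.
elim: {-2}l (leqnn l) => [|n IHn] le_nl; first by left; exists a; rewrite mul1r.
have [[b aE]|[v [u [lt_v u_unit aE]]]] := IHn (ltnW le_nl); last first.
  by right; exists v, u; split=> //; apply: ltn_trans lt_v _.
have [b_unit|] := boolP (b \is a GRing.unit); first by right; exists n, b.
rewrite unit_pi negbK => /eqP/ker_pi[c bE].
by left; exists c; rewrite aE bE exprSr mulrA.
Qed.

Lemma varpi_mul_eq0 (e : nat) (a : R) :
  (e <= l)%N -> varpi ^+ e * a = 0 -> exists b, a = varpi ^+ (l - e) * b.
Proof.
move=> le_el; have [->|[v [u [lt_v u_unit ->]]]] := chain_factor a.
  by exists 0; rewrite mulr0.
rewrite mulrA -exprD => /eqP; rewrite mulIr_eq0; last exact: mulIr.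
rewrite varpi_expr_eq0 -leq_subLR => le_v.
by exists (varpi ^+ (v - (l - e)) * u); rewrite mulrA -exprD subnKC.
Qed.

Lemma scalemx_varpi_eq0 (m n e : nat) (M : 'M[R]_(m, n)) :
  (e <= l)%N -> varpi ^+ e *: M = 0 -> exists M', M = varpi ^+ (l - e) *: M'.
Proof.
move=> le_el M0; apply: scalemx_factor => i j; apply: varpi_mul_eq0 => //.
by have /matrixP/(_ i j) := M0; rewrite !mxE.
Qed.

Lemma map_pi_eq0 (m n : nat) (M : 'M[R]_(m, n)) :
  map_mx pi M = 0 -> exists M', M = varpi *: M'.
Proof.
move=> M0; apply: scalemx_factor => i j; apply/ker_pi.
by have /matrixP/(_ i j) := M0; rewrite !mxE.
Qed.

Lemma map_pi_scale (m n e : nat) (M : 'M[R]_(m, n)) :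
  (0 < e)%N -> map_mx pi (varpi ^+ e *: M) = 0.
Proof. by case: e => // e _; rewrite map_mxZ /= rmorphXn /= pi_varpi expr0n scale0r. Qed.

Lemma map_pi_eq (m n e : nat) (M M' : 'M[R]_(m, n)) :
  (e < l)%N -> varpi ^+ e *: (M - M') = 0 -> map_mx pi M = map_mx pi M'.
Proof.
move=> lt_el /(scalemx_varpi_eq0 (ltnW lt_el))[D DE].
by apply/eqP; rewrite -subr_eq0 -map_mxB DE map_pi_scale // subn_gt0.
Qed.

Lemma unitmx_pi (n : nat) (A : 'M[R]_n) : (A \in unitmx) = (map_mx pi A \in unitmx).
Proof. by rewrite !unitmxE det_map_mx unitfE unit_pi. Qed.

Lemma map_poly_pi_surj (Q : {poly k}) : exists P : {poly R}, map_poly pi P = Q.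
Proof.
elim/poly_ind: Q => [|Q c [P PE]]; first by exists 0; rewrite rmorph0.
have [a aE] := pi_surj c; exists (P * 'X + a%:P).
by rewrite rmorphD rmorphM /= map_polyX map_polyC /= PE aE.
Qed.

(* Successive approximation: the quotient by varpi of a commuting matrix minus a polynomial
   in X commutes with X to one order less. *)
Lemma commuting_is_horner (n i : nat) (X M : 'M[R]_n.+1) :
  Defs.regular_mx (map_mx pi X) -> (i <= l)%N ->
  varpi ^+ (l - i) *: (M *m X - X *m M) = 0 ->
  exists P, varpi ^+ (l - i) *: (M - horner_mx X P) = 0.
Proof.
move=> X_reg; elim: i M => [|i IHi] M le_il comm.
  by exists 0; rewrite subn0 varpi_l scale0r.
have lt_e : (l - i.+1 < l)%N by rewrite ltn_subrL chain_length_gt0.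
have := map_pi_eq lt_e comm; rewrite !map_mxM /= => pi_comm.
have [Q QE] := regular_centralizer X_reg (esym pi_comm).
have [P PE] := map_poly_pi_surj Q.
have [M1 M1E] : exists M1, M - horner_mx X P = varpi *: M1.
  by apply: map_pi_eq0; rewrite map_mxB map_horner_mx PE -QE subrr.
have XP : horner_mx X P *m X = X *m horner_mx X P by apply: comm_horner_mx.
have lE : (l - i = (l - i.+1).+1)%N by rewrite subnSK.
have [|P1 P1E] := IHi M1 (ltnW le_il).
  rewrite lE exprSr -scalerA [varpi *: _]scalerBr scalemxAl scalemxAr -M1E.
  by rewrite mulmxBl mulmxBr XP opprB addrA addrNK.
exists (P + varpi *: P1).
rewrite rmorphD /= linearZ /= opprD addrA M1E -scalerBr scalerA -exprSr -lE.
exact: P1E.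
Qed.

End ChainRing.

(** * Congruence subgroups *)

Lemma KkerP (n : nat) (R : finComUnitRingType) (varpi : R) (i : nat) (g : {'GL_n[R]}) :
  reflect (exists Y, GLval g = 1 + varpi ^+ i *: Y) (g \in Kker n varpi i.+1).
Proof. by rewrite inE; apply: (iffP existsP) => -[Y YE]; exists Y; apply/eqP. Qed.

Lemma Kker_group_set (n : nat) (R : finComUnitRingType) (varpi : R) (i : nat) :
  group_set (Kker n varpi i.+1).
Proof.
apply/group_setP; split; first by apply/KkerP; exists 0; rewrite scaler0 addr0.
move=> g h /KkerP[Y gE] /KkerP[Z hE]; apply/KkerP; exists (Z + Y * (1 + varpi ^+ i *: Z)).
by rewrite GL_ME gE hE mulrDl mul1r -scalerAl -addrA -scalerDr.
Qed.

(** The index is shifted: [Kker_group n varpi i] has underlying set [Kker n varpi i.+1], so that it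
    is the group K^i of matrices congruent to 1 modulo [varpi ^+ i]. *)
Canonical Kker_group (n : nat) (R : finComUnitRingType) (varpi : R) (i : nat) :=
  Group (Kker_group_set n varpi i).

Lemma conj_mx_sub (n : nat) (R : finComUnitRingType) (g : {'GL_n[R]}) (M : 'M[R]_n.-1.+1) :
  GLval g * (1 + M) * (GLval g)^-1 = 1 + GLval g * M * (GLval g)^-1.
Proof. by rewrite mulrDr mulrDl mulr1 divrr // GL_unit. Qed.

Lemma Kker_normal (n : nat) (R : finComUnitRingType) (varpi : R) (i : nat) :
  Kker_group n varpi i <| 'GL_n[R].
Proof.
rewrite /normal subsetT; apply/subsetP=> g _; rewrite -groupV inE.
apply/subsetP=> _ /imsetP[z /KkerP[Y zE] ->]; apply/KkerP.
exists (GLval g * Y * (GLval g)^-1).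
by rewrite conjgE invgK !GL_ME GL_VE zE mulrA conj_mx_sub -scalerAr -scalerAl.
Qed.

Lemma Kker_sub (n : nat) (R : finComUnitRingType) (varpi : R) (i j : nat) :
  (j <= i)%N -> Kker n varpi i.+1 \subset Kker n varpi j.+1.
Proof.
move=> le_ji; apply/subsetP=> g /KkerP[Y gE]; apply/KkerP.
by exists (varpi ^+ (i - j) *: Y); rewrite scalerA -exprD subnKC.
Qed.

Section Congruence.
Variables (R : finComUnitRingType) (varpi : R) (l : nat)
  (k : finFieldType) (pi : {rmorphism R -> k}).
Hypotheses (varpi_l : varpi ^+ l = 0) (varpi_neq0 : varpi ^+ l.-1 != 0).
Hypothesis ker_pi : forall a : R, pi a = 0 <-> exists b, a = varpi * b.
Hypothesis pi_surj : forall c : k, exists a, pi a = c.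

Lemma exists_Kker (n i : nat) (Y : 'M[R]_n.-1.+1) : (0 < i)%N ->
  exists2 g, g \in Kker n varpi i.+1 & GLval g = 1 + varpi ^+ i *: Y.
Proof.
move=> i_gt0; have [g gE] : exists g : {'GL_n[R]}, GLval g = 1 + varpi ^+ i *: Y.
  apply: exists_GLval; rewrite (unitmx_pi varpi_l ker_pi pi_surj).
  rewrite map_mxD (map_pi_scale ker_pi) // addr0 map_mx1.
  exact: unitmx1.
by exists g => //; apply/KkerP; exists Y.
Qed.

Lemma mem_Kker (n i : nat) (g : {'GL_n[R]}) : (i <= l)%N ->
  varpi ^+ (l - i) *: (GLval g - 1) = 0 -> g \in Kker n varpi i.+1.
Proof.
move=> le_il; have le_e := leq_subr i l.
move=> /(scalemx_varpi_eq0 varpi_l varpi_neq0 ker_pi pi_surj le_e)[Y YE].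
by apply/KkerP; exists Y; rewrite subKn // in YE; rewrite -YE addrC subrK.
Qed.

(** In the factorisation of g^p - 1 by g - 1 the cofactor is congruent to p, hence to 0, modulo
    [varpi]. *)
Lemma Kker_expr_p (n i p : nat) (g : {'GL_n[R]}) : p \in [pchar k] -> (0 < i)%N ->
  g \in Kker n varpi i.+1 -> (g ^+ p)%g \in Kker n varpi i.+2.
Proof.
move=> p_char i_gt0 /KkerP[Y gE]; apply/KkerP.
pose s := \sum_(j < p) GLval g ^+ j.
have [W WE] : exists W, s = varpi *: W.
  apply: (map_pi_eq0 ker_pi); rewrite raddf_sum /=.
  rewrite (eq_bigr (fun=> 1)) => [|j _].
    by rewrite sumr_const card_ord -mulr_natr -scaler_nat (pcharf0 p_char) scale0r mulr0.
  by rewrite rmorphXn /= gE map_mxD (map_pi_scale ker_pi) // addr0 map_mx1 expr1n.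
exists (Y * W); have := subrX1 (GLval g) p; rewrite -/s {2}gE addrAC subrr add0r WE.
rewrite -scalerAl -scalerAr scalerA -exprSr => E.
have -> : GLval (g ^+ p)%g = GLval g ^+ p by elim: (p) => // q IHq; rewrite expgS exprS -IHq.
by rewrite -E addrC subrK.
Qed.

Lemma Kker_pgroup (n p : nat) : p \in [pchar k] -> p.-group (Kker_group n varpi 1).
Proof.
move=> p_char; have p_pr := pcharf_prime p_char.
have expK (g : {'GL_n[R]}) a : g \in Kker n varpi 2 -> (g ^+ (p ^ a))%g \in Kker n varpi a.+2.
  move=> Kg; elim: a => [|a IHa]; first by rewrite expg1.
  by rewrite expnSr expgM; apply: Kker_expr_p.
apply/pgroupP=> q q_pr /(Cauchy q_pr)[g Kg order_g].
have g1 : (g ^+ (p ^ l))%g = 1%g.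
  have /KkerP[Y gE] := expK g l Kg; apply: GLval_inj.
  by rewrite gE exprSr varpi_l mul0r scale0r addr0.
have : (q %| p ^ l)%N by rewrite -order_g order_dvdn g1.
by rewrite Euclid_dvdX // dvdn_prime2 // => /andP[/eqP-> _]; rewrite inE.
Qed.

End Congruence.

(** * The characters phi_X *)

Lemma exists_irr_of_morphism (gT : finGroupType) (K : {group gT}) (f : gT -> algC) :
  f 1%g = 1 -> {in K &, forall x y, f (x * y)%g = f x * f y} ->
  exists2 t : Iirr K, 'chi_t \is a linear_char & {in K, 'chi_t =1 f}.
Proof.
move=> f1 fM; pose r (g : gT) : 'M[algC]_1 := (f g)%:M.
have r_repr : mx_repr K r.
  by split=> [|x y Kx Ky]; rewrite /r ?f1 // fM // scalar_mxM.
pose rK := MxRepresentation r_repr.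
have fE : {in K, cfRepr rK =1 f}.
  by move=> g Kg; rewrite cfunE Kg mulr1n /= mxtrace_scalar.
have lin_f : cfRepr rK \is a linear_char by rewrite qualifE /= cfRepr_char cfRepr1 eqxx.
have /irrP[t tE] := lin_char_irr lin_f.
by exists t; rewrite -tE.
Qed.

Section AdditiveCharacter.
Variables (R : finComUnitRingType) (varpi : R) (l : nat)
  (k : finFieldType) (pi : {rmorphism R -> k}) (phi : R -> algC).
Hypotheses (varpi_l : varpi ^+ l = 0) (varpi_neq0 : varpi ^+ l.-1 != 0).
Hypothesis ker_pi : forall a : R, pi a = 0 <-> exists b, a = varpi * b.
Hypothesis pi_surj : forall c : k, exists a, pi a = c.
Hypotheses (phi0 : phi 0 = 1) (phiD : forall a b, phi (a + b) = phi a * phi b).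
Hypothesis phi_nontrivial : exists a, phi (varpi ^+ l.-1 * a) != 1.

Lemma additive_char_norm (a : R) : `|phi a| = 1.
Proof.
have phiMn m : phi (a *+ m) = phi a ^+ m.
  by elim: m => [|m IHm]; rewrite ?mulr0n ?phi0 // mulrS phiD IHm exprS.
have phi_order : phi a ^+ #[a]%g = 1.
  by rewrite -phiMn (_ : a *+ _ = 0) // -FinRing.zmodXgE expg_order.
by apply/eqP; rewrite -(@pexpr_eq1 _ _ #[a]%g) // -normrX phi_order normr1.
Qed.

(** The multiples of a nonzero [a] include the ideal generated by [varpi ^+ l.-1], on which [phi] is
    nontrivial. *)
Lemma additive_char_nondegenerate (a : R) : (forall b, phi (a * b) = 1) -> a = 0.
Proof.
move=> phi_a; have [//|[v [u [lt_v u_unit aE]]]] := chain_factor varpi_l ker_pi pi_surj a.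
have [c /eqP[]] := phi_nontrivial.
have <- := phi_a (u^-1 * varpi ^+ (l.-1 - v) * c); congr phi.
rewrite aE !mulrA; congr (_ * c); rewrite mulrK // -exprD subnKC //.
by case: l lt_v.
Qed.

Lemma trace_nondegenerate (n : nat) (M : 'M[R]_n.+1) :
  (forall B, phi (\tr (M *m B)) = 1) -> M = 0.
Proof.
move=> phi_M; apply/matrixP=> i j; rewrite mxE.
apply: additive_char_nondegenerate => b.
have <- := phi_M (b *: delta_mx j i); congr phi.
rewrite -scalemxAr mxtraceZ mulrC; congr (_ * _).
rewrite /mxtrace (bigD1 i) //= big1 => [|i' i'_neq]; last first.
  by rewrite mxE big1 // => j' _; rewrite mxE (negPf i'_neq) andbF mulr0.
rewrite addr0 mxE (bigD1 j) //= big1 => [|j' j'_neq]; last by rewrite mxE (negPf j'_neq) mulr0.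
by rewrite mxE !eqxx mulr1 addr0.
Qed.

Lemma sum_trace_char (n : nat) (M : 'M[R]_n.+1) :
  \sum_B phi (\tr (M *m B)) = #|{: 'M[R]_n.+1}|%:R *+ (M == 0).
Proof.
have [->|M_neq0] := eqVneq M 0.
  rewrite (eq_bigr (fun=> 1)) => [|B _]; last by rewrite mul0mx mxtrace0 phi0.
  by rewrite sumr_const.
have [B0 phi_B0] : exists B0, phi (\tr (M *m B0)) != 1.
  apply/existsP; apply: contraNT M_neq0; rewrite negb_exists => /forallP M1.
  by apply/eqP/trace_nondegenerate => B; have := M1 B; rewrite negbK => /eqP.
set s := \sum_B _; apply/eqP; rewrite mulr0n.
have : phi (\tr (M *m B0)) * s = s.
  rewrite /s mulr_sumr [RHS](reindex_inj (addrI B0)) /=; apply: eq_bigr => B _.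
  by rewrite mulmxDr mxtraceD phiD.
move/eqP; rewrite -subr_eq0 -[X in _ - X]mul1r -mulrBl mulf_eq0 subr_eq0.
by rewrite (negPf phi_B0).
Qed.

Lemma phi_x1 (n : nat) (X : 'M[R]_n.-1.+1) : phi_x phi X 1%g = 1.
Proof. by rewrite /phi_x GL_1E subrr mulmx0 mxtrace0. Qed.

(** The quadratic term of the product is divisible by [varpi ^+ (i + i)], which is 0. *)
Lemma phi_xM (n i : nat) (X : 'M[R]_n.-1.+1) (g h : {'GL_n[R]}) :
  (l <= i + i)%N -> g \in Kker n varpi i.+1 -> h \in Kker n varpi i.+1 ->
  phi_x phi X (g * h)%g = phi_x phi X g * phi_x phi X h.
Proof.
move=> le_lii /KkerP[Y gE] /KkerP[Z hE]; rewrite /phi_x -phiD -mxtraceD -mulmxDr.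
congr (phi (\tr (_ *m _))); rewrite GL_ME gE hE ![1 + _ - 1]addrAC !subrr !add0r.
rewrite mulrDl mul1r mulrDr mulr1 -scalerAl -scalerAr scalerA -exprD.
rewrite -(subnKC le_lii) exprD varpi_l mul0r scale0r addr0 addrAC [1 + _]addrC addrK.
by rewrite addrC.
Qed.

(* Averaging phi_X over all lifts X of x gives phi_xhat on K^(l-1) extended by zero. *)
Lemma exists_phi_x_lift (n i : nat) (xhat : 'M[R]_n.-1.+1) (chi : {'GL_n[R]} -> algC) :
  (i < l)%N -> (l <= i + i)%N ->
  res_contains (Kker n varpi l) chi (phi_x phi xhat) ->
  exists2 X, map_mx pi X = map_mx pi xhat &
    res_contains (Kker n varpi i.+1) chi (phi_x phi X).
Proof.
move=> lt_il le_lii contains; have l_gt0 := leq_ltn_trans (leq0n i) lt_il.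
have [Z Z_contains] : exists Z, res_contains (Kker n varpi i.+1) chi
    (phi_x phi (xhat + varpi *: Z)).
  apply/existsP; apply: contraNT contains; rewrite negb_exists => /forallP none.
  have sum0 : \sum_Z \sum_(g in Kker n varpi i.+1)
      chi g * (phi_x phi (xhat + varpi *: Z) g)^* = 0.
    by rewrite big1 // => Z _; apply/eqP; have := none Z; rewrite negbK.
  have card_neq0 : #|{: 'M[R]_n.-1.+1}|%:R != 0 :> algC.
    by rewrite pnatr_eq0 -lt0n; apply/card_gt0P; exists 0.
  rewrite -(inj_eq (mulIf card_neq0)) mul0r eq_sym -[X in X == _]sum0 exchange_big /= mulr_suml.
  apply/eqP; rewrite (big_setID (Kker n varpi l)) /=.
  have -> : Kker n varpi i.+1 :&: Kker n varpi l = Kker n varpi l.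
    by apply/setIidPr; rewrite -(prednK l_gt0); apply: Kker_sub; rewrite -ltnS prednK.
  have phiE g : \sum_Z (phi_x phi (xhat + varpi *: Z) g)^* =
      (phi_x phi xhat g)^* * (#|{: 'M[R]_n.-1.+1}|%:R *+ (varpi *: (GLval g - 1) == 0)).
    have -> : #|{: 'M[R]_n.-1.+1}|%:R *+ (varpi *: (GLval g - 1) == 0)
        = (#|{: 'M[R]_n.-1.+1}|%:R *+ (varpi *: (GLval g - 1) == 0))^* :> algC.
      by rewrite -mulrnA conj_natr ?natr_nat.
    rewrite -sum_trace_char -rmorphM mulr_sumr rmorph_sum /=; apply: eq_bigr => Z _.
    rewrite /phi_x -phiD mulmxDl mxtraceD; congr (phi (_ + _))^*.
    by rewrite -!scalemxAl !mxtraceZ mxtrace_mulC.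
  rewrite [X in _ + X]big1 ?addr0 => [|g /setDP[_ g_notin]]; last first.
    rewrite -mulr_sumr phiE; case: eqP => [g1|]; last by rewrite mulr0n !mulr0.
    case/negP: g_notin; rewrite -(prednK l_gt0).
    apply: (mem_Kker varpi_l varpi_neq0 ker_pi pi_surj); first exact: leq_pred.
    by rewrite -{1}(prednK l_gt0) subSnn expr1.
  apply: eq_bigr => g Kg; rewrite -mulr_sumr phiE -mulrA.
  have /KkerP[Y gE] : g \in Kker n varpi l.-1.+1 by rewrite prednK.
  by rewrite gE [1 + _]addrC addrK scalerA -exprS (prednK l_gt0) varpi_l scale0r eqxx mulr1n.
exists (xhat + varpi *: Z) => //.
by rewrite map_mxD -[varpi]expr1 (map_pi_scale ker_pi) // addr0.
Qed.

End AdditiveCharacter.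

(** * Characters of the determinant *)

(** The witness is the diagonal matrix with entries [1 + a], 1, ..., 1. *)
Lemma exists_GL_det (n : nat) (R : finComUnitRingType) (a : R) : 1 + a \is a GRing.unit ->
  exists g : {'GL_n[R]}, \det (GLval g) = 1 + a /\ exists D, GLval g = 1 + a *: D.
Proof.
move=> a_unit; pose d : 'rV[R]_n.-1.+1 := \row_j (if j == 0 then 1 + a else 1).
have det_d : \det (diag_mx d) = 1 + a.
  rewrite det_diag big_ord_recl mxE eqxx big1 ?mulr1 // => j _.
  by rewrite mxE.
have [g gE] : exists g : {'GL_n[R]}, GLval g = diag_mx d.
  by apply: exists_GLval; rewrite unitmxE det_d.
exists g; rewrite gE det_d; split=> //; exists (delta_mx 0 0).
apply/matrixP=> i j; rewrite !mxE.
have [<-|ij] := eqVneq i j; first by rewrite andbb; case: (i == 0); rewrite ?mulr1 ?mulr0 ?addr0.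
have [i0|] := eqVneq i 0; last by rewrite mulr0 addr0.
by have [j0|] := eqVneq j 0; [rewrite i0 j0 eqxx in ij | rewrite mulr0 addr0].
Qed.

Lemma det_GL_X (n : nat) (R : finComUnitRingType) (g : {'GL_n[R]}) (m : nat) :
  \det (GLval (g ^+ m)%g) = \det (GLval g) ^+ m.
Proof. by elim: m => [|m IHm]; rewrite ?det1 // expgS exprS -IHm -det_mulmx. Qed.

Lemma expr_coprime_eq1 (A : comNzRingType) (x : A) (m m' : nat) :
  coprime m m' -> x ^+ m = 1 -> x ^+ m' = 1 -> x = 1.
Proof.
case: m => [|m]; first by rewrite /coprime gcd0n => /eqP-> _; rewrite expr1.
move=> /eqP cop xm xm'; have [s s' gcdE _] := egcdnP m' (ltn0Sn m).
have := congr1 (GRing.exp x) gcdE; rewrite cop exprD !(mulnC s) !(mulnC s') !exprM.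
by rewrite xm xm' !expr1n mul1r expr1 => <-.
Qed.

Lemma SL_normal (n : nat) (R : finComUnitRingType) : SL_group n R <| 'GL_n[R].
Proof.
rewrite /normal subsetT; apply/subsetP=> g _; rewrite inE; apply/subsetP=> _ /imsetP[h SLh ->].
move: SLh; rewrite !inE => /eqP det_h; rewrite conjgE !GL_MxE !det_mulmx det_h mul1r -det_mulmx
  -GL_MxE.
by rewrite mulVg det1.
Qed.

Lemma abelian_GL_SL (n : nat) (R : finComUnitRingType) : abelian ('GL_n[R] / SL_group n R).
Proof.
apply: sub_der1_abelian; rewrite gen_subG; apply/subsetP=> _ /imset2P[g h _ _ ->].
have dM (x y : {'GL_n[R]}) : \det (GLval (x * y)%g) = \det (GLval x) * \det (GLval y).
  by rewrite GL_MxE det_mulmx.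
have dV (x : {'GL_n[R]}) : \det (GLval x^-1) * \det (GLval x) = 1 by rewrite -dM mulVg det1.
rewrite inE; apply/eqP; rewrite /commg conjgE !dM.
transitivity ((\det (GLval g^-1) * \det (GLval g)) * (\det (GLval h^-1) * \det (GLval h))).
  by ring.
by rewrite !dV mulr1.
Qed.

Section DeterminantCharacters.
Variables (R : finComUnitRingType) (varpi : R) (l : nat)
  (k : finFieldType) (pi : {rmorphism R -> k}) (p n : nat).
Hypotheses (varpi_l : varpi ^+ l = 0) (varpi_neq0 : varpi ^+ l.-1 != 0).
Hypothesis ker_pi : forall a : R, pi a = 0 <-> exists b, a = varpi * b.
Hypothesis pi_surj : forall c : k, exists a, pi a = c.
Hypotheses (p_char : p \in [pchar k]) (p_ndvd : ~~ (p %| n)%N).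

(** [lambda] is 1 at scalars, where ['chi_i] does not vanish. This makes it trivial on K^1, and [g]
    has the determinant of an element of K^1. *)
Lemma twist_eq1_of_det (i : Iirr 'GL_n[R]) (lambda : 'CF('GL_n[R])) (g : {'GL_n[R]}) :
  lambda \is a linear_char -> SL_group n R \subset cfker lambda ->
  'chi_i * lambda = 'chi_i -> pi (\det (GLval g)) = 1 -> lambda g = 1.
Proof.
move=> lin_lam kerSL fix_lam det_g.
have n_gt0 : (0 < n)%N by case: n p_ndvd => //; rewrite dvdn0.
have inG (h : {'GL_n[R]}) : h \in 'GL_n[R] by rewrite inE.
have lamM (h h' : {'GL_n[R]}) : lambda (h * h')%g = lambda h * lambda h' by apply: lin_charM.
have lam_det (h h' : {'GL_n[R]}) : \det (GLval h) = \det (GLval h') -> lambda h = lambda h'.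
  move=> det_hh'; rewrite -(mulgKV h' h) lamM.
  have : (h * h'^-1)%g \in SL_group n R.
    by rewrite inE GL_MxE det_mulmx det_hh' -det_mulmx -GL_MxE mulgV det1.
  by move/(subsetP kerSL)/cfker1 => ->; rewrite lin_char1 // mul1r.
have lam_scalar (a : R) (z : {'GL_n[R]}) : GLval z = a%:M -> lambda z = 1.
  move=> zE; have z_center : z \in 'Z('GL_n[R])%g.
    rewrite inE inG; apply/centP=> h _; apply: GLval_inj.
    by rewrite !GL_MxE zE scalar_mxC.
  have /eqP norm_z : `|'chi_i z| == 'chi_i 1%g.
    by rewrite -irr_cfcenterE //; move: z_center; rewrite -cap_cfcenter_irr => /bigcapP->.
  have z_neq0 : 'chi_i z != 0 by rewrite -normr_eq0 norm_z irr1_neq0.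
  have := congr1 (fun xi : 'CF('GL_n[R]) => xi z) fix_lam; rewrite cfunE.
  by rewrite -[RHS]mulr1 => /(mulfI z_neq0).
(* [h ^+ n] has the determinant of the scalar matrix [\det h], so [lambda h] is an [n]-th root of 1;
   it is also a root of 1 of [p]-power order, as K^1 is a [p]-group. *)
have lamK h : h \in Kker_group n varpi 1 -> lambda h = 1.
  move=> Kh; have [z zE] : exists z : {'GL_n[R]}, GLval z = (\det (GLval h))%:M.
    by apply: exists_GLval; rewrite unitmxE det_scalar unitrX // -unitmxE; apply: GL_unit.
  have pK := Kker_pgroup varpi_l ker_pi n p_char.
  have lam_n : lambda h ^+ n = 1.
    rewrite -lin_charX // -(lam_scalar _ _ zE); apply: lam_det.
    by rewrite det_GL_X zE det_scalar; congr (_ ^+ _); rewrite prednK.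
  apply: expr_coprime_eq1 lam_n (lin_char_unity_root lin_lam (inG h)).
  have p_pr := pcharf_prime p_char.
  rewrite coprime_sym; apply: pnat_coprime (mem_p_elt pK Kh) _.
  by rewrite p'natE.
have /ker_pi[b bE] : pi (\det (GLval g) - 1) = 0 by rewrite rmorphB rmorph1 det_g subrr.
have detE : 1 + varpi * b = \det (GLval g) by rewrite -bE addrC subrK.
have [|h [det_h [D hE]]] := @exists_GL_det n R (varpi * b).
  by rewrite detE -unitmxE; apply: GL_unit.
rewrite (lam_det g h) ?lamK //; last by rewrite det_h detE.
by apply/KkerP; exists (b *: D); rewrite hE scalerA expr1.
Qed.

(** For [N] equal to [#|k|.-1] divided by iota this is the group T of elements whose determinant is
    an iota-th power modulo [varpi], the units of [k] being cyclic. *)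
Definition det_power_kernel (N : nat) : {set {'GL_n[R]}} :=
  [set g | pi (\det (GLval g)) ^+ N == 1].

Lemma pi_det_unit (g : {'GL_n[R]}) : pi (\det (GLval g)) \is a GRing.unit.
Proof. by apply: rmorph_unit; rewrite -unitmxE; apply: GL_unit. Qed.

Definition det_power (N : nat) (g : {'GL_n[R]}) : {unit k} :=
  FinRing.unit _ (rpredX N (pi_det_unit g)).

Lemma det_powerM (N : nat) :
  {in 'GL_n[R] &, {morph det_power N : g h / (g * h)%g}}.
Proof.
move=> g h _ _; apply: val_inj => /=.
by rewrite det_mulmx rmorphM exprMn.
Qed.

Canonical det_power_morphism N := Morphism (det_powerM N).

Lemma det_power_kernelE (N : nat) : det_power_kernel N = 'ker (det_power N).
Proof. by apply/setP=> g; rewrite !inE -val_eqE. Qed.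

Lemma det_power_kernel_group_set (N : nat) : group_set (det_power_kernel N).
Proof. by rewrite det_power_kernelE; apply: groupP. Qed.

Canonical det_power_kernel_group N := Group (det_power_kernel_group_set N).

Lemma det_power_kernel_normal (N : nat) : det_power_kernel N <| 'GL_n[R].
Proof. by rewrite det_power_kernelE ker_normal. Qed.

Lemma det_power_kernel_index (N : nat) : (N %| #|k|.-1)%N ->
  #|'GL_n[R] : det_power_kernel N| = (#|k|.-1 %/ N)%N.
Proof.
move=> N_dvd; have k_gt0 : (0 < #|k|.-1)%N by rewrite -ltnS prednK ?finNzRing_gt1 // ltnW
  ?finNzRing_gt1.
have N_gt0 : (0 < N)%N by apply: dvdn_gt0 N_dvd.
have /cyclicP[w wE] := field_unit_group_cyclic [set: {unit k}]%G.
have order_w : #[w]%g = #|k|.-1 by rewrite -card_finField_unit orderE -wE.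
rewrite det_power_kernelE -{1}(setIid 'GL_n[R]) -card_morphim -order_w -orderXdiv ?order_w //.
rewrite orderE; congr #|pred_of_set _|; apply/setP=> v; apply/morphimP/cycleP.
  case=> g _ _ ->.
  have /cycleP[a aE] : FinRing.unit _ (pi_det_unit g) \in <[w]>%g by rewrite -wE inE.
  exists a; rewrite -expgM mulnC expgM -aE; apply: val_inj.
  by rewrite FinRing.val_unitX.
case=> a ->; have [b bE] := pi_surj (FinRing.uval (w ^+ a)%g).
have b_unit : 1 + (b - 1) \is a GRing.unit.
  by rewrite addrC subrK (unit_pi varpi_l ker_pi pi_surj) bE -unitfE; apply: valP.
have [g [det_g _]] := @exists_GL_det n R (b - 1) b_unit.
exists g; rewrite ?inE //; apply: val_inj => /=.
by rewrite det_g [1 + _]addrC subrK bE -FinRing.val_unitX -!expgM mulnC.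
Qed.

End DeterminantCharacters.

(** * The stabiliser of phi_X *)

Section Inertia.
Variables (R : finComUnitRingType) (varpi : R) (l : nat)
  (k : finFieldType) (pi : {rmorphism R -> k}) (phi : R -> algC).
Hypotheses (varpi_l : varpi ^+ l = 0) (varpi_neq0 : varpi ^+ l.-1 != 0).
Hypothesis ker_pi : forall a : R, pi a = 0 <-> exists b, a = varpi * b.
Hypothesis pi_surj : forall c : k, exists a, pi a = c.
Hypotheses (phi0 : phi 0 = 1) (phiD : forall a b, phi (a + b) = phi a * phi b).
Hypothesis phi_nontrivial : exists a, phi (varpi ^+ l.-1 * a) != 1.
Variables (n : nat) (X : 'M[R]_n.-1.+1) (i j : nat).
Hypothesis X_reg : Defs.regular_mx (map_mx pi X).
Hypotheses (j_gt0 : (0 < j)%N) (ijl : (i + j)%N = l) (le_ji : (j <= i)%N) (le_ij : (i <= j.+1)%N).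

Local Notation G := 'GL_n[R].
Local Notation K := (Kker_group n varpi).
Variable t : Iirr (K i).
Hypothesis tE : {in K i, 'chi_t =1 phi_x phi X}.
Local Notation S := 'I_G['chi_t].

Let i_gt0 : (0 < i)%N. Proof. exact: leq_trans le_ji. Qed.

Lemma phi_x_conj (g z : {'GL_n[R]}) (Y : 'M[R]_n.-1.+1) : GLval z = 1 + varpi ^+ i *: Y ->
  phi_x phi X (z ^ g^-1)%g = phi_x phi X z *
    phi (\tr ((varpi ^+ i *: ((GLval g)^-1 * X * GLval g - X)) *m Y)).
Proof.
move=> zE; rewrite /phi_x -phiD -mxtraceD; congr phi.
rewrite conjgE invgK !GL_ME GL_VE zE mulrA conj_mx_sub.
rewrite [1 + _ - 1]addrAC subrr add0r [1 + _ - 1]addrAC subrr add0r.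
rewrite !mulmxE -!(scalerAl, scalerAr) -scalerDr !mxtraceZ; congr (_ * _).
by rewrite mulrBl addrC subrK mulrA -[in LHS]mulmxE mxtrace_mulC mulmxE !mulrA.
Qed.

(** Conjugation by [g] changes phi_X by a trace pairing with the difference of [X] and its
    conjugate, and this pairing is nondegenerate. *)
Lemma inertia_commuting (g : {'GL_n[R]}) :
  (g \in S) = (varpi ^+ i *: (GLval g * X - X * GLval g) == 0).
Proof.
have nKg : g \in 'N(K i) by apply: (subsetP (normal_norm (Kker_normal n varpi i))); rewrite inE.
have commE : varpi ^+ i *: (GLval g * X - X * GLval g)
    = - (GLval g * (varpi ^+ i *: ((GLval g)^-1 * X * GLval g - X))).
  rewrite -scalerAr mulrBr !mulrA divrr ?GL_unit // mul1r -scalerN opprB.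
  by [].
have -> : (varpi ^+ i *: (GLval g * X - X * GLval g) == 0)
    = (varpi ^+ i *: ((GLval g)^-1 * X * GLval g - X) == 0).
  rewrite commE oppr_eq0 mulrI_eq0 //; exact/mulrI/GL_unit.
rewrite in_setI inE inE nKg /=; apply/eqP/eqP=> [fix_t|comm0].
  apply: (trace_nondegenerate varpi_l ker_pi pi_surj phi_nontrivial) => Y.
  have [z Kz zE] := exists_Kker varpi_l ker_pi pi_surj Y i_gt0.
  have := congr1 (fun xi : 'CF(K i) => xi z) fix_t; rewrite cfConjgE //.
  rewrite !tE ?memJ_norm ?groupV // (phi_x_conj g zE).
  rewrite -[RHS]mulr1; apply: mulfI.
  by rewrite -normr_eq0 additive_char_norm // oner_eq0.
apply/cfun_inP=> z Kz; rewrite cfConjgE // !tE ?memJ_norm ?groupV //.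
have /KkerP[Y zE] := Kz.
by rewrite (phi_x_conj g zE) comm0 mul0mx mxtrace0 phi0 mulr1.
Qed.

Lemma Kker_sub_inertia : Kker n varpi j.+1 \subset S.
Proof.
apply/subsetP=> h /KkerP[B hE]; rewrite inertia_commuting hE mulrDl mulrDr mul1r mulr1.
rewrite opprD addrACA subrr add0r -scalerAl -scalerAr -scalerBr scalerA -exprD ijl varpi_l.
by rewrite scale0r.
Qed.

(** [g] agrees modulo [varpi ^+ e] with a polynomial [a] in [X], invertible because [g] is; then [h]
    is [a^-1 * g]. *)
Lemma commuting_factor (e : nat) (g : {'GL_n[R]}) : (0 < e <= l)%N ->
  varpi ^+ (l - e) *: (GLval g * X - X * GLval g) = 0 ->
  exists (P : {poly R}) (a h : {'GL_n[R]}),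
    [/\ g = (a * h)%g, GLval a = horner_mx X P & h \in Kker n varpi e.+1].
Proof.
case/andP=> e_gt0 le_el comm.
have [P PE] := commuting_is_horner varpi_l varpi_neq0 ker_pi pi_surj X_reg le_el comm.
have lt_l : (l - e < l)%N by rewrite ltn_subrL e_gt0 (leq_trans e_gt0).
have [a aE] : exists a : {'GL_n[R]}, GLval a = horner_mx X P.
  apply: exists_GLval; rewrite (unitmx_pi varpi_l ker_pi pi_surj).
  rewrite -(map_pi_eq varpi_l varpi_neq0 ker_pi pi_surj lt_l PE).
  by rewrite -(unitmx_pi varpi_l ker_pi pi_surj) -[_ \in _]/(GLval g \is a GRing.unit) GL_unit.
exists P, a, (a^-1 * g)%g; split=> //; first by rewrite mulKVg.
apply: (mem_Kker varpi_l varpi_neq0 ker_pi pi_surj) => //.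
rewrite GL_ME GL_VE -[X in _ - X](mulVr (GL_unit a)) -mulrBr scalerAr aE PE.
by rewrite mulr0.
Qed.

Lemma inertia_factor (g : {'GL_n[R]}) : g \in S ->
  exists (P : {poly R}) (a h : {'GL_n[R]}),
    [/\ g = (a * h)%g, GLval a = horner_mx X P & h \in Kker n varpi j.+1].
Proof.
rewrite inertia_commuting => /eqP comm; apply: commuting_factor.
  by rewrite j_gt0 -ijl leq_addl.
by rewrite -ijl addnK.
Qed.

Local Notation J := (S :&: K 1).

Lemma Kker_sub_radical : Kker n varpi j.+1 \subset J.
Proof. by rewrite subsetI Kker_sub_inertia; apply: (@Kker_sub n R varpi j 1). Qed.

(* For g in J and h = 1 + varpi^j B the commutator [g, h] lies in K^i, where phi_X takes the
   value phi(varpi^j tr((X - g X g^-1) B)). *)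
Lemma commutator_separates (g : {'GL_n[R]}) :
  g \in J -> varpi ^+ j *: (GLval g * X - X * GLval g) != 0 ->
  exists2 h, h \in Kker n varpi j.+1 & [~ g, h] \in Kker n varpi i.+1 /\ phi_x phi X [~ g, h] != 1.
Proof.
case/setIP=> Sg /KkerP[Y gE] ncomm.
pose D := X - GLval g * X * (GLval g)^-1.
have D_neq0 : varpi ^+ j *: D != 0.
  apply: contraNneq ncomm => D0; rewrite -oppr_eq0 -scalerN opprB.
  have -> : X * GLval g - GLval g * X = D * GLval g.
    by rewrite mulrBl -[in RHS](mulrA _ _ (GLval g)) mulVr ?GL_unit // mulr1.
  by rewrite scalerAl D0 mul0r.
have [B phi_B] : exists B, phi (\tr ((varpi ^+ j *: D) *m B)) != 1.
  apply/existsP; apply: contraNT D_neq0; rewrite negb_exists => /forallP D1; apply/eqP.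
  apply: (trace_nondegenerate varpi_l ker_pi pi_surj phi_nontrivial) => B.
  by have := D1 B; rewrite negbK => /eqP.
have [h Kh hE] := exists_Kker varpi_l ker_pi pi_surj B j_gt0.
(* Since [g] is 1 modulo [varpi], one more power of [varpi] is gained; this puts the commutator in
   K^i even when [i = j.+1]. *)
have [W gBE] : exists W, GLval g * B - B * GLval g = varpi *: W.
  by exists (Y * B - B * Y); rewrite gE expr1 mulrDl mulrDr mul1r mulr1 opprD addrACA subrr
    add0r -scalerAl -scalerAr -scalerBr.
have commE : GLval [~ g, h] = 1 + varpi ^+ j.+1 *: ((GLval g)^-1 * (GLval h)^-1 * W).
  have ghE : GLval g * GLval h = GLval h * GLval g + varpi ^+ j.+1 *: W.
    rewrite exprSr -scalerA -gBE hE !mulrDr !mulrDl mul1r mulr1 -scalerAr -scalerAl.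
    by rewrite scalerBr -addrA [_ *: (B * _) + _]addrC subrK.
  rewrite /commg conjgE !mulgA !GL_ME !GL_VE -!mulrA ghE !mulrDr mulKr ?GL_unit // mulVr
    ?GL_unit //.
  by rewrite -!scalerAr.
have varpi_h : varpi ^+ j.+1 *: (GLval h)^-1 = varpi ^+ j.+1 *: (1 : 'M[R]_n.-1.+1).
  have E : varpi ^+ j.+1 *: GLval h = varpi ^+ j.+1 *: 1.
    rewrite hE scalerDr scalerA -exprD.
    have le_l : (l <= j.+1 + j)%N by rewrite -ijl leq_add2r.
    by rewrite -(subnKC le_l) exprD varpi_l mul0r scale0r addr0.
  rewrite -[in RHS](mulVr (GL_unit h)) -[LHS]mulr1 -scalerAl scalerAr -E -scalerAr.
  by [].
exists h => //; split.
  apply: (subsetP (Kker_sub n varpi le_ij)); apply/KkerP.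
  by exists ((GLval g)^-1 * (GLval h)^-1 * W).
suff -> : phi_x phi X [~ g, h] = phi (\tr ((varpi ^+ j *: D) *m B)) by [].
rewrite /phi_x commE [1 + _]addrC addrK; congr phi.
have -> : varpi ^+ j.+1 *: ((GLval g)^-1 * (GLval h)^-1 * W)
    = varpi ^+ j *: ((GLval g)^-1 * (GLval g * B - B * GLval g)).
  rewrite gBE -[in RHS]scalerAr scalerA -exprSr -mulrA scalerAr scalerAl varpi_h.
  by rewrite -scalerAl mul1r -scalerAr.
rewrite mulrBr mulKr ?GL_unit // -scalemxAr -scalemxAl !mxtraceZ; congr (_ * _).
rewrite /D mulmxBr mulmxBl !raddfB /=; congr (_ - _).
by rewrite !mulmxE !mulrA -mulmxE mxtrace_mulC mulmxE !mulrA.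
Qed.

(** By the commutator criterion ['chi_u] vanishes unless [g] commutes with [X] up to a multiple of
    [varpi ^+ i]. Such a [g] is a polynomial in [X], which [c] centralises, times an element of K^i,
    where ['chi_u] is a multiple of the [c]-invariant ['chi_t]. *)
Lemma radical_irr_invariant (u : Iirr J) (c : {'GL_n[R]}) :
  'Res[K i] 'chi_u = 'chi_u 1%g *: 'chi_t -> GLval c * X = X * GLval c ->
  ('chi_u ^ c)%CF = 'chi_u.
Proof.
move=> res_u cX.
have Sc : c \in S by rewrite inertia_commuting cX subrr scaler0.
have sKJ : K i \subset J.
  by apply: subset_trans Kker_sub_radical; apply: Kker_sub.
have nJc : c \in 'N(J).
  apply: (subsetP (_ : S \subset 'N(J))) => //; rewrite normsI ?normG //.
  by apply: subset_trans (normal_norm (Kker_normal n varpi 1)); apply: Inertia_sub.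
have uE z : z \in K i -> 'chi_u z = 'chi_u 1%g * 'chi_t z.
  by move=> Kz; rewrite -(cfResE _ sKJ) // res_u cfunE.
have norm_u z : z \in K i -> `|'chi_u z| = 'chi_u 1%g.
  move=> Kz; rewrite uE // normrM (tE Kz) additive_char_norm // mulr1.
  by rewrite ger0_norm // ltW // irr1_gt0.
have u_mul g z : g \in J -> z \in K i -> 'chi_u (g * z)%g = 'chi_u g * 'chi_t z.
  move=> Jg Kz; apply: (mulIf (irr1_neq0 u)).
  rewrite irr_scalar_mul ?norm_u //; last exact: (subsetP sKJ).
  by rewrite (uE z Kz) mulrA mulrAC.
have u0 g : g \in J -> varpi ^+ j *: (GLval g * X - X * GLval g) != 0 -> 'chi_u g = 0.
  move=> Jg /(commutator_separates Jg)[h Kh [Kgh phi_gh]].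
  apply: (@irr_commutator_eq0 _ _ u g h) => //.
  - exact: (subsetP Kker_sub_radical).
  - exact: norm_u.
  - rewrite uE // tE // -[X in _ != X]mulr1 (inj_eq (mulfI (irr1_neq0 u))).
    exact: phi_gh.
apply/cfun_inP=> g Jg; rewrite cfConjgE //.
have Jgc : (g ^ c^-1)%g \in J by rewrite memJ_norm ?groupV.
have [comm|ncomm] := eqVneq (varpi ^+ j *: (GLval g * X - X * GLval g)) 0; last first.
  rewrite !u0 //; apply: contraNneq ncomm => comm.
  have -> : varpi ^+ j *: (GLval g * X - X * GLval g)
    = (GLval c)^-1 * (varpi ^+ j *: (GLval (g ^ c^-1)%g * X - X * GLval (g ^ c^-1)%g)) * GLval c.
    have cXV : (GLval c)^-1 * X = X * (GLval c)^-1 by apply/esym/commrV/esym/cX.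
    rewrite conjgE invgK !GL_ME GL_VE -scalerAr -scalerAl; congr (_ *: _).
    rewrite mulrBr mulrBl !mulrA mulVr ?GL_unit // mul1r -!mulrA; congr (_ - _).
      by rewrite -cX mulKr ?GL_unit.
    by rewrite !mulrA cXV -!mulrA mulKr ?GL_unit // mulVr ?GL_unit // mulr1.
  by rewrite comm mulr0 mul0r.
have [||P [a [z [gE aE Kz]]]] := @commuting_factor i g.
- by rewrite i_gt0 -ijl leq_addr.
- by rewrite -ijl addKn.
have ca : (a ^ c^-1 = a)%g.
  apply: GLval_inj; rewrite conjgE invgK !GL_ME GL_VE aE mulrA.
  rewrite (_ : GLval c * horner_mx X P = horner_mx X P * GLval c) ?mulrK ?GL_unit //.
  exact: comm_mx_horner.
have Ja : a \in J by rewrite -(groupMr _ (subsetP sKJ _ Kz)) -gE.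
rewrite gE conjMg ca !u_mul //; last first.
  by rewrite memJ_norm // groupV (subsetP (normal_norm (Kker_normal n varpi i))) ?inE.
have /setIP[_ /setIdP[nKc /eqP inv_c]] := Sc.
by congr (_ * _); rewrite -[RHS](congr1 (fun xi : 'CF(K i) => xi z) inv_c) cfConjgE.
Qed.

Variable p : nat.
Hypotheses (p_char : p \in [pchar k]) (p_ndvd : ~~ (p %| n)%N).

(** [a] is the product of its primary constituents, which are powers of [a] and so commute with [X].
    The [p]-part is treated by its determinant, the others by [twist_fixed_eq1]. *)
Lemma twist_horner_eq1 (chi : Iirr G) (lambda : 'CF(G)) (s : Iirr S)
    (P : {poly R}) (a : {'GL_n[R]}) :
  lambda \is a linear_char -> SL_group n R \subset cfker lambda ->
  'chi_chi * lambda = 'chi_chi -> 'chi_s * 'Res[S] lambda = 'chi_s ->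
  t \in irr_constt ('Res[K i] 'chi_s) ->
  GLval a = horner_mx X P -> lambda a = 1.
Proof.
move=> lin_lam kerSL fix_lam fix_s s_t aE.
have p_pr := pcharf_prime p_char.
have inG (h : {'GL_n[R]}) : h \in G by rewrite inE.
have lam_det (h : {'GL_n[R]}) : pi (\det (GLval h)) = 1 -> lambda h = 1.
  exact: (twist_eq1_of_det varpi_l ker_pi p_char p_ndvd lin_lam kerSL fix_lam).
rewrite -[a]prod_constt lin_char_prod // big1 // => r _.
have [r_pr|r_npr] := boolP (prime r); last first.
  rewrite (constt1P _) ?lin_char1 //; apply/pnatP=> // q q_pr _.
  by rewrite !inE; apply: contraNneq r_npr => <-.
set c := (a.`_r)%g; have r_c : r.-elt c := p_elt_constt r a.
have [m cE] : exists m, c = (a ^+ m)%g by apply/cycleP/mem_cycle.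
have aX : comm_mx (GLval a) X by rewrite aE; apply: comm_horner_mx.
have cX : GLval c * X = X * GLval c.
  rewrite cE; elim: (m) => [|m' IHm]; first by rewrite mul1r mulr1.
  by rewrite expgS GL_ME -mulrA IHm !mulrA -mulmxE aX.
have Sc : c \in S by rewrite inertia_commuting cX subrr scaler0.
have [r_p|r_neq_p] := eqVneq r p.
  (* The order of [c] is a power of [p], prime to [#|k|.-1], so its determinant is 1 modulo
     [varpi]. *)
  apply: lam_det; apply: (@expr_coprime_eq1 _ _ #[c]%g #|k|.-1).
  - apply: (@pnat_coprime p); first by rewrite -r_p.
    rewrite p'natE //; apply/negP=> p_dvd.
    have /p_natP[e kE] : p.-nat #|k|.
      by have := pprimeChar_pgroup p_char; rewrite /pgroup cardsT.
    have k_gt1 := finNzRing_gt1 k.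
    have p_dvd_k : (p %| #|k|)%N by rewrite kE; case: (e) kE k_gt1 => [->|e' _ _] //;
      apply: dvdn_exp.
    have := p_dvd_k; rewrite -(prednK (ltnW k_gt1)) -addn1 dvdn_addr // dvdn1.
    by move/eqP=> p1; rewrite p1 in p_pr.
  - by rewrite -rmorphXn /= -det_GL_X expg_order det1 rmorph1.
  have := pi_det_unit pi c; rewrite unitfE => det_neq0.
  have k_gt0 := ltnW (finNzRing_gt1 k).
  by apply: (mulfI det_neq0); rewrite mulr1 -exprS (prednK k_gt0) expf_card.
have nsJS : J <| S by rewrite /normal subsetIl normsI ?normG // (subset_trans (Inertia_sub _ _))
  // normal_norm ?Kker_normal.
have pJ : p.-group J by apply: pgroupS (subsetIr _ _) (Kker_pgroup varpi_l ker_pi n p_char).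
have sSG : S \subset G := Inertia_sub _ _.
have nsKS : K i <| S.
  apply: normalS (Kker_normal n varpi i); last exact: Inertia_sub.
  exact: sub_Inertia (normal_sub (Kker_normal n varpi i)).
have lin_t : 'chi_t \is a linear_char by rewrite qualifE /= irr_char (tE (group1 _)) (phi_x1
  phi0) eqxx.
rewrite -(cfResE lambda sSG Sc).
apply: (@twist_fixed_eq1 _ S J p r s ('Res[S] lambda) c) => //.
- exact: cfRes_lin_char.
- apply/subsetP=> h Jh; have /setIP[Sh /KkerP[Y hE]] := Jh.
  rewrite cfkerEchar ?lin_charW ?cfRes_lin_char // inE Sh cfRes1 lin_char1 // cfResE //.
  apply/eqP/lam_det.
  by rewrite -det_map_mx hE map_mxD (map_pi_scale ker_pi) // addr0 map_mx1 det1.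
- move=> u s_u; apply: radical_irr_invariant cX.
  apply: constt_Res_invariant lin_t s_t s_u => //; first exact: subsetIl.
    by apply: subset_trans Kker_sub_radical; apply: Kker_sub.
  exact: subsetIr.
move=> g Sg; have [Q [b [h [gE bE Kh]]]] := inertia_factor Sg.
exists b, h; split=> //; last exact: (subsetP Kker_sub_radical).
  have bX : horner_mx X Q *m X = X *m horner_mx X Q by apply: comm_horner_mx.
  by rewrite inertia_commuting bE -!mulmxE bX subrr scaler0.
rewrite cE; apply: commuteX; apply: GLval_inj.
by rewrite !GL_ME aE bE; apply: comm_horner_mx2.
Qed.

Lemma Res_SL_multiplicity_free (chi : Iirr G) (tau : nat -> nat -> nat) :
  n_typical n tau -> tau_regular (map_mx pi X) tau ->
  t \in irr_constt ('Res[K i] 'chi_chi) ->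
  exists A : {set Iirr (SL_group n R)}, #|A| = iota_tau n tau (#|k| - 1) /\
    'Res[SL_group n R] 'chi_chi = \sum_(u in A) 'chi_u.
Proof.
move=> tau_typ X_tau chi_t; set iota := iota_tau _ _ _.
have k_gt0 := ltnW (finNzRing_gt1 k).
have q_gt0 : (0 < #|k|.-1)%N by rewrite -ltnS (prednK k_gt0) finNzRing_gt1.
have iota_dvd : (iota %| #|k|.-1)%N by rewrite -subn1 dvdn_gcdl.
pose N := (#|k|.-1 %/ iota)%N.
have NiE : (N * iota)%N = #|k|.-1 by rewrite divnK.
have N_dvd : (N %| #|k|.-1)%N by rewrite -NiE dvdn_mulr.
have N_gt0 : (0 < N)%N by apply: dvdn_gt0 N_dvd.
have iota_gt0 : (0 < iota)%N by apply: dvdn_gt0 iota_dvd.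
have iotaE : iota = #|G : det_power_kernel pi n N|.
  by rewrite (det_power_kernel_index n varpi_l ker_pi pi_surj N_dvd) -NiE mulKn.
have inG (h : {'GL_n[R]}) : h \in G by rewrite inE.
have [s [indE s_t fix_s]] := clifford_correspondent (Kker_normal n varpi i) chi_t.
have pi_horner (P : {poly R}) (a : {'GL_n[R]}) : GLval a = horner_mx X P ->
    pi (\det (GLval a)) = \det (horner_mx (map_mx pi X) (map_poly pi P)).
  by move=> aE; rewrite -det_map_mx aE map_horner_mx.
have pi_unit (a : {'GL_n[R]}) : pi (\det (GLval a)) != 0 by rewrite -unitfE; apply: pi_det_unit.
rewrite iotaE; apply: (@Res_multiplicity_free _ G (SL_group n R) (det_power_kernel_group pi n N)
  'I_G['chi_t]%G chi s) => //.
- exact: SL_normal.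
- exact: det_power_kernel_normal.
- by apply/subsetP=> g; rewrite !inE => /eqP->; rewrite rmorph1 expr1n.
- exact: abelian_GL_SL.
(* Modulo [varpi] the determinant is that of the polynomial factor, an [iota]-th power, and
   [N * iota] is the order of the units of [k]. *)
- apply/subsetP=> g /inertia_factor[P [a [h [gE aE /KkerP[Y hE]]]]].
  have [u uE] := det_horner_iota tau_typ X_tau (map_poly pi P).
  have a_neq0 := pi_unit a; rewrite inE gE GL_MxE det_mulmx rmorphM /=.
  have -> : pi (\det (GLval h)) = 1.
    by rewrite -det_map_mx hE map_mxD (map_pi_scale ker_pi) // addr0 map_mx1 det1.
  rewrite mulr1 (pi_horner P a aE) uE -exprM mulnC NiE; apply/eqP.
  have u_neq0 : u != 0.
    apply: contraNneq a_neq0 => u0; rewrite (pi_horner P a aE) uE u0 expr0n.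
    by rewrite -/iota eqn0Ngt iota_gt0.
  by apply: (mulfI u_neq0); rewrite mulr1 -exprS (prednK k_gt0) expf_card.
(* The determinant of [g] modulo [varpi] is an [iota]-th power, hence that of a unit [a] polynomial
   in [X]; [lambda] is 1 at [a] and only depends on this determinant. *)
move=> lambda lin_lam kerSL fix_lam; apply/subsetP=> g.
rewrite inE => /eqP gN1.
have [u uE] := finField_root N_gt0 (esym NiE) gN1.
have u_neq0 : u != 0.
  apply: contraNneq (pi_unit g) => u0; rewrite -uE u0 expr0n.
  by rewrite eqn0Ngt iota_gt0.
have [Q QE] := exists_det_horner_iota n X_tau u_neq0.
have [P PE] := map_poly_pi_surj pi_surj Q.
have [a aE] : exists a : {'GL_n[R]}, GLval a = horner_mx X P.
  apply: exists_GLval; rewrite (unitmx_pi varpi_l ker_pi pi_surj) map_horner_mx PE.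
  by rewrite unitmxE QE unitfE expf_neq0.
have lam_a : lambda a = 1.
  apply: (twist_horner_eq1 lin_lam kerSL fix_lam (fix_s _ lin_lam _ fix_lam) s_t aE).
  apply/subsetP=> z /KkerP[Y zE]; rewrite cfkerEchar ?lin_charW // inE inG lin_char1 //.
  apply/eqP; apply: (twist_eq1_of_det varpi_l ker_pi p_char p_ndvd lin_lam kerSL fix_lam).
  by rewrite -det_map_mx zE map_mxD (map_pi_scale ker_pi) // addr0 map_mx1 det1.
rewrite cfkerEchar ?lin_charW // inE inG lin_char1 //.
rewrite -(mulgKV a g) lin_charM // lam_a mulr1; apply/eqP.
apply: (twist_eq1_of_det varpi_l ker_pi p_char p_ndvd lin_lam kerSL fix_lam).
have gaE : pi (\det (GLval g)) = pi (\det (GLval a)) by rewrite (pi_horner P a aE) PE QE uE.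
apply: (mulIf (pi_unit a)); rewrite mul1r -rmorphM -det_mulmx -GL_MxE mulgKV.
exact: gaE.
Qed.

End Inertia.

Theorem theorem6p8
  (R : finComUnitRingType) (varpi : R) (l : nat)
  (k : finFieldType) (pi : {rmorphism R -> k}) (p n : nat)
  (phi : R -> algC) (tau : nat -> nat -> nat)
  (i : Iirr 'GL_n[R]) :
  (* R = o_l = o / varpi^l o : varpi nilpotent of index exactly l, residue map pi *)
  (2 <= l)%N ->
  varpi ^+ l = 0 -> varpi ^+ l.-1 != 0 ->
  (forall a : R, pi a = 0 <-> exists b, a = varpi * b) ->
  (forall c : k, exists a, pi a = c) ->
  (* p = char k is odd and does not divide n *)
  p \in [pchar k] -> odd p -> ~~ (p %| n)%N ->
  (* phi : additive character of o_l, nontrivial on varpi^(l-1) o_l *)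
  phi 0 = 1 -> (forall a b, phi (a + b) = phi a * phi b) ->
  (exists a, phi (varpi ^+ l.-1 * a) != 1) ->
  (* tau n-typical, and rho = 'Chi_i is tau-regular *)
  n_typical n tau ->
  (exists xhat : 'M[R]_n.-1.+1,
      tau_regular (map_mx pi xhat) tau /\
      res_contains (Kker n varpi l) 'chi_i (phi_x phi xhat)) ->
  (* Res^{GL}_{SL} rho is a sum of iota(tau,q-1) pairwise distinct irreducibles *)
  exists S : {set Iirr (SL_group n R)},
    #|S| = iota_tau n tau (#|k| - 1) /\
    'Res[SL_group n R] 'chi_i = \sum_(j in S) 'chi_j.
Proof.
move=> l_ge2 varpi_l varpi_neq0 ker_pi pi_surj p_char _ p_ndvd phi0 phiD phi_nontrivial.
move=> tau_typ [xhat [xhat_tau contains]].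
(* [j] and [e] are the halves of [l] rounded down and up: [l <= e + e] makes phi_X multiplicative on
   K^e, and [e <= j.+1] is what the commutator computation requires. *)
pose j := l./2; pose e := (l - j)%N.
have le_j_l : (j <= l)%N by rewrite -[X in (_ <= X)%N]odd_double_half -addnn addnA leq_addl.
have lE : l = (odd l + (j + j))%N by rewrite addnn odd_double_half.
have eE : e = (odd l + j)%N by rewrite /e {1}lE addnA addnK.
have j_gt0 : (0 < j)%N by rewrite half_gt0.
have ejl : (e + j)%N = l by rewrite subnK.
have le_je : (j <= e)%N by rewrite eE leq_addl.
have le_ej : (e <= j.+1)%N by rewrite eE -add1n leq_add2r leq_b1.
have lt_el : (e < l)%N by rewrite -ejl -[X in (X < _)%N]addn0 ltn_add2l.
have le_lee : (l <= e + e)%N by rewrite -[X in (X <= _)%N]ejl leq_add2l.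
have [X X_xhat X_contains] := exists_phi_x_lift varpi_l varpi_neq0 ker_pi pi_surj phi0 phiD
  phi_nontrivial lt_el le_lee contains.
rewrite -X_xhat in xhat_tau.
have [t lin_t tE] : exists2 t : Iirr (Kker_group n varpi e),
    'chi_t \is a linear_char & {in Kker_group n varpi e, 'chi_t =1 phi_x phi X}.
  apply: exists_irr_of_morphism; first exact: phi_x1.
  by move=> g h Kg Kh; apply: (phi_xM varpi_l phiD X le_lee).
have i_t : t \in irr_constt ('Res[Kker_group n varpi e] 'chi_i).
  rewrite irr_consttE cfdotE mulf_neq0 ?invr_eq0 ?neq0CG //.
  move: X_contains; rewrite /res_contains; apply: contra => /eqP sum0; rewrite -[X in _ == X]sum0.
  apply/eqP/eq_bigr => g Kg; rewrite tE // cfResE ?normal_sub ?Kker_normal //.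
exact: (Res_SL_multiplicity_free varpi_l varpi_neq0 ker_pi pi_surj phi0 phiD phi_nontrivial
  xhat_tau.1 j_gt0 ejl le_je le_ej tE p_char p_ndvd tau_typ xhat_tau i_t).
Qed.
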